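(* Let $f\colon\mathcal E\to\mathcal B$ be a weak fibration of $\infty$-bicategories. Then an edge of $\mathcal E$ is $f$-cartesian if and only if it is weakly $f$-cartesian. If $f$ is an outer fibration, then an edge of $\mathcal E$ is $f$-cartesian if and only if it is strongly $f$-cartesian. In particular, in the latter case all three classes of edges coincide.
   Context: A scaled simplicial set is a pair $(X,T_X)$ of a simplicial set and a set $T_X$ of 2-simplices (thin triangles) containing the degenerate ones; maps preserve thin triangles. $X_\flat$: only degenerate triangles thin. $(X,T)$ means: thin triangles are those of $T$ and the degenerate ones; $T_{|L}$ is the set of triangles of $L\subseteq X$ lying in $T$. An $\infty$-bicategory is a scaled simplicial set with the extension property against: (i) $(\Lambda^n_i,\{\Delta^{\{i-1,i,i+1\}}\}_{|\Lambda^n_i})\to(\Delta^n,\{\Delta^{\{i-1,i,i+1\}}\})$, $0<i<n$; (ii) $(\Delta^4,T)\to(\Delta^4,T\cup\{\Delta^{\{0,3,4\}},\Delta^{\{0,1,4\}}\})$, $T=\{\Delta^{\{0,2,4\}},\Delta^{\{1,2,3\}},\Delta^{\{0,1,3\}},\Delta^{\{1,3,4\}},\Delta^{\{0,1,2\}}\}$; (iii) $(\Lambda^n_0\coprod_{\Delta^{\{0,1\}}}\Delta^0,\{\Delta^{\{0,1,n\}}\})\to(\Delta^n\coprod_{\Delta^{\{0,1\}}}\Delta^0,\{\Delta^{\{0,1,n\}}\})$, $n\ge3$. A weak fibration is a map of scaled simplicial sets with the right lifting property against the maps (i) and against $(\Lambda^n_0\coprod_{\Delta^{\{0,1\}}}\Delta^0,\{\Delta^{\{0,1,n\}}\}_{|\Lambda^n_0})\subseteq(\Delta^n\coprod_{\Delta^{\{0,1\}}}\Delta^0,\{\Delta^{\{0,1,n\}}\})$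 and $(\Lambda^n_n\coprod_{\Delta^{\{n-1,n\}}}\Delta^0,\{\Delta^{\{0,n-1,n\}}\}_{|\Lambda^n_n})\subseteq(\Delta^n\coprod_{\Delta^{\{n-1,n\}}}\Delta^0,\{\Delta^{\{0,n-1,n\}}\})$, $n\ge2$. It is an outer fibration if it detects thin triangles (a triangle is thin iff its image is) and the underlying map of simplicial sets has the right lifting property against $\Lambda^n_0\coprod_{\Delta^{\{0,1\}}}\Delta^0\subseteq\Delta^n\coprod_{\Delta^{\{0,1\}}}\Delta^0$ and $\Lambda^n_n\coprod_{\Delta^{\{n-1,n\}}}\Delta^0\subseteq\Delta^n\coprod_{\Delta^{\{n-1,n\}}}\Delta^0$, $n\ge2$. Let $f\colon X\to S$ be a weak fibration and $e$ an edge of $X$. Consider, for $n\ge2$, lifting problems of an inclusion $(\Lambda^n_n,T_{|\Lambda^n_n})\subseteq(\Delta^n,T)$ against $f$ whose top map $\sigma$ satisfies $\sigma_{|\Delta^{\{n-1,n\}}}=e$. Then $e$ is: $f$-cartesian if lifts always exist for $T=\{\Delta^{\{0,n-1,n\}}\}$ (and all $n\ge 2$); weakly $f$-cartesian if lifts always exist for $T$ the set of all triangles which are degenerate or contain the edge $\Delta^{\{n-1,n\}}$; strongly $f$-cartesian if lifts always exist for $(\Lambda^n_n)_\flat\subseteq\Delta^n_\flat$. *)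

(* Defs.v *)
From HB Require Import structures.
From mathcomp Require Import all_boot.
Set Implicit Arguments.
Unset Strict Implicit.
Unset Printing Implicit Defensive.

Definition monotone m n (f : {ffun 'I_m.+1 -> 'I_n.+1}) : bool :=
  [forall i : 'I_m.+1, forall j : 'I_m.+1, (i <= j) ==> (f i <= f j)].

Record ordmap (m n : nat) := Ordmap {
  ordmap_fun :> {ffun 'I_m.+1 -> 'I_n.+1};
  ordmap_mono : monotone ordmap_fun }.

HB.instance Definition _ m n := [isSub for @ordmap_fun m n].

Lemma ordmapP m n (f : ordmap m n) (i j : 'I_m.+1) : i <= j -> f i <= f j.
Proof. by have /forallP/(_ i)/forallP/(_ j)/implyP := ordmap_mono f. Qed.

Lemma ordmap_eq m n (f g : ordmap m n) : f =1 g -> f = g.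
Proof. by move=> fg; apply/val_inj/ffunP. Qed.

Fact ordid_mono n : monotone [ffun i : 'I_n.+1 => i].
Proof. by apply/forallP=> i; apply/forallP=> j; rewrite !ffunE implybb. Qed.
Definition ordid n : ordmap n n := Ordmap (ordid_mono n).

Fact ordcomp_mono m n p (g : ordmap n p) (f : ordmap m n) :
  monotone [ffun i => g (f i)].
Proof.
apply/forallP=> i; apply/forallP=> j; apply/implyP=> le_ij.
by rewrite !ffunE; do 2!apply: ordmapP.
Qed.
Definition ordcomp m n p (g : ordmap n p) (f : ordmap m n) : ordmap m p :=
  Ordmap (ordcomp_mono g f).

Lemma ordcompE m n p (g : ordmap n p) (f : ordmap m n) i :
  ordcomp g f i = g (f i).
Proof. by rewrite ffunE. Qed.

Record sset := Sset {
  simp :> nat -> Type;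
  act : forall m n, ordmap m n -> simp n -> simp m;
  act_id : forall n (x : simp n), act (ordid n) x = x;
  act_comp : forall m n p (g : ordmap n p) (f : ordmap m n) (x : simp p),
    act (ordcomp g f) x = act f (act g x) }.
Arguments act {s m n} f x.

Record smap (X Y : sset) := Smap {
  smap_fun :> forall n, X n -> Y n;
  smap_nat : forall m n (f : ordmap m n) (x : X n),
    @smap_fun m (act f x) = act f (@smap_fun n x) }.
Arguments smap_fun {X Y} s n x.

Definition smap_id (X : sset) : smap X X :=
  @Smap X X (fun _ x => x) (fun _ _ _ _ => erefl).

Definition degenerate (X : sset) n (x : X n) : Prop :=
  exists m (s : ordmap n m) (y : X m), m < n /\ x = act s y.

Lemma degenerate_map (X Y : sset) (f : smap X Y) n (x : X n) :
  degenerate x -> degenerate (f n x).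
Proof.
by move=> [m [s [y [lt_mn ->]]]]; exists m, s, (f m y); rewrite smap_nat.
Qed.

Record subsset (X : sset) := Subsset {
  smem : forall n, pred (X n);
  smem_act : forall m n (f : ordmap m n) (x : X n),
    smem x -> smem (act f x) }.
Arguments smem {X} s {n} x.

Section SubSimplicialSet.
Variables (X : sset) (A : subsset X).

Definition sub_simp n := {x : X n | smem A x}.
Definition sub_act m n (f : ordmap m n) (x : sub_simp n) : sub_simp m :=
  exist _ (act f (val x)) (smem_act f (valP x)).
Fact sub_act_id n (x : sub_simp n) : sub_act (ordid n) x = x.
Proof. by apply: val_inj; rewrite /= act_id. Qed.
Fact sub_act_comp m n p (g : ordmap n p) (f : ordmap m n) (x : sub_simp p) :
  sub_act (ordcomp g f) x = sub_act f (sub_act g x).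
Proof. by apply: val_inj; rewrite /= act_comp. Qed.

Definition sub_sset : sset := Sset sub_act_id sub_act_comp.
Definition sub_incl : smap sub_sset X :=
  @Smap sub_sset X (fun _ x => val x) (fun _ _ _ _ => erefl).
End SubSimplicialSet.

Definition sub_preim (X Y : sset) (f : smap X Y) (B : subsset Y) : subsset X.
Proof.
exists (fun n x => smem B (f n x)) => m n g x Bx.
by rewrite smap_nat smem_act.
Defined.

Section Simplex.
Variable n : nat.

Fact std_act_id m (g : ordmap m n) : ordcomp g (ordid m) = g.
Proof. by apply: ordmap_eq => i; rewrite ordcompE ffunE. Qed.
Fact std_act_comp m p q (g : ordmap p q) (f : ordmap m p) (x : ordmap q n) :
  ordcomp x (ordcomp g f) = ordcomp (ordcomp x g) f.
Proof. by apply: ordmap_eq => i; rewrite !ordcompE. Qed.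

Definition std : sset :=
  @Sset (fun m => ordmap m n) (fun m p f x => ordcomp x f)
        std_act_id std_act_comp.

Definition vertices m (g : std m) : seq nat :=
  [seq nat_of_ord (g k) | k : 'I_m.+1].

Definition face (J : seq nat) : subsset std.
Proof.
exists (fun m (g : ordmap m n) => [forall k, (g k : nat) \in J]).
move=> m p f g /forallP gJ; apply/forallP=> k /=.
by rewrite ffunE; apply: gJ.
Defined.

(* The [i]-th horn: the simplices missing some vertex other than [i]. *)
Definition horn (i : 'I_n.+1) : subsset std.
Proof.
exists (fun m (g : ordmap m n) =>
          [exists j, (j != i) && [forall k, g k != j]]).
move=> m p f g /existsP[j /andP[ji /forallP gj]].
apply/existsP; exists j; rewrite ji /=; apply/forallP=> k.
by rewrite ffunE; apply: gj.
Defined.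

(* The triangle with vertices a <= b <= c is designated by [:: a; b; c]. *)
Definition triangles (L : seq (seq nat)) : std 2 -> Prop :=
  fun g => vertices g \in L.

Definition contains_edge (a b : nat) : std 2 -> Prop :=
  fun g => exists h : ordmap 1 2, vertices (act h g) = [:: a; b].
End Simplex.

Definition horn_incl n (i : 'I_n.+1) : smap (sub_sset (horn i)) (std n) :=
  sub_incl (horn i).

(* The edge on which the definition of cartesian edges below imposes a condition
   exists and is unique. *)
Lemma vertices_inj n m : injective (@vertices n m).
Proof.
move=> g h /eq_in_map gh; apply/ordmap_eq=> i.
by apply/val_inj/gh; rewrite mem_enum.
Qed.

Lemma last_edge_horn n : 1 < n ->
  exists d : sub_sset (horn (@ord_max n)) 1,
    vertices (horn_incl ord_max 1 d) = [:: n.-1; n].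
Proof.
case: n => [//|[//|n]] _.
pose g := [ffun i : 'I_2 => inord (n.+1 + i) : 'I_n.+3].
have gE i : g i = n.+1 + i :> nat.
  by rewrite ffunE inordK // -(addn2 n.+1) ltn_add2l ltn_ord.
have g_mono : monotone g.
  apply/forallP=> i; apply/forallP=> j; apply/implyP=> le_ij.
  by rewrite !gE leq_add2l.
have g_horn : smem (horn ord_max) (Ordmap g_mono : std n.+2 1).
  apply/existsP; exists ord0; apply/andP; split=> //; apply/forallP=> k.
  by rewrite -val_eqE /= gE.
exists (exist (fun x : std n.+2 1 => smem (horn ord_max) x) _ g_horn).
by rewrite /vertices /image_mem enum_ordSl enum_ordSl enum_ord0 /= !gE addn0 addn1.
Qed.

Section Collapse.
Variables (X : sset) (A : subsset X).

(* Levelwise, the pushout of [X n] and a point along [A n] is the complement of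
   [A n] with a point [None] added. *)
Definition collapse_simp n := option {x : X n | ~~ smem A x}.
Definition collapse_fun n (x : X n) : collapse_simp n := insub x.
Definition collapse_act m n (f : ordmap m n) (x : collapse_simp n) :
    collapse_simp m :=
  obind (fun y => collapse_fun (act f (val y))) x.

Fact collapse_nat m n (f : ordmap m n) (x : X n) :
  collapse_fun (act f x) = collapse_act f (collapse_fun x).
Proof.
rewrite /collapse_fun /collapse_act; case: (@insubP _ _ _ x) => [y _ <- //|].
by rewrite negbK => Ax; rewrite /= insubN // negbK smem_act.
Qed.
Fact collapse_act_id n (x : collapse_simp n) : collapse_act (ordid n) x = x.
Proof. by case: x => // x; rewrite /= /collapse_fun act_id valK. Qed.
Fact collapse_act_comp m n p (g : ordmap n p) (f : ordmap m n)
    (x : collapse_simp p) :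
  collapse_act (ordcomp g f) x = collapse_act f (collapse_act g x).
Proof. by case: x => // x; rewrite /= act_comp collapse_nat. Qed.

Definition collapse : sset := Sset collapse_act_id collapse_act_comp.
Definition collapse_proj : smap X collapse :=
  @Smap X collapse collapse_fun collapse_nat.
Definition collapse_pt : smap (std 0) collapse :=
  @Smap (std 0) collapse (fun _ _ => None) (fun _ _ _ _ => erefl).

Lemma collapse_projT n (x : X n) (t : std 0 n) :
  smem A x -> collapse_proj n x = collapse_pt n t.
Proof. by move=> Ax; rewrite /= /collapse_fun insubN // negbK. Qed.

Lemma collapse_universal (Y : sset) (u : smap X Y) (p : smap (std 0) Y) :
  (forall n (x : X n) (t : std 0 n), smem A x -> u n x = p n t) ->
  exists w : smap collapse Y,
    [/\ forall n x, w n (collapse_proj n x) = u n x,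
        forall n t, w n (collapse_pt n t) = p n t
      & forall w' : smap collapse Y,
          (forall n x, w' n (collapse_proj n x) = u n x) ->
          (forall n t, w' n (collapse_pt n t) = p n t) ->
          forall n y, w' n y = w n y].
Proof.
move=> up.
have cst_mono n : monotone [ffun _ : 'I_n.+1 => ord0 : 'I_1].
  by apply/forallP=> i; apply/forallP=> j; rewrite !ffunE leqnn implybT.
pose cst n : std 0 n := Ordmap (cst_mono n).
have cstE n (t : std 0 n) : t = cst n.
  by apply: ordmap_eq => i; rewrite !ord1.
pose w n (y : collapse n) : Y n :=
  if y is Some x then u n (val x) else p n (cst n).
have wu n (x : X n) : w n (collapse_proj n x) = u n x.
  rewrite /= /collapse_fun; case: insubP => [y _ <- //|].
  by rewrite negbK => Ax; rewrite /= (up _ _ (cst n)).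
have w_nat m n (f : ordmap m n) (y : collapse n) :
    w m (act f y) = act f (w n y).
  case: y => [x|] /=; last by rewrite -smap_nat (cstE _ (act f (cst n))).
  by rewrite -smap_nat; apply: wu.
exists (Smap w_nat); split=> //= [n t|w' w'u w'p n y].
  by rewrite [t]cstE.
case: y => [x|]; last exact: w'p (cst n).
by rewrite /= -w'u /= /collapse_fun valK.
Qed.
End Collapse.

Section CollapseMap.
Variables (X Y : sset) (f : smap X Y) (B : subsset Y).

Definition collapse_map_fun n (x : collapse_simp (sub_preim f B) n) :
    collapse_simp B n :=
  obind (fun y => collapse_fun B (f n (val y))) x.

Fact collapse_map_nat m n (g : ordmap m n)
    (x : collapse_simp (sub_preim f B) n) :
  collapse_map_fun (collapse_act g x) = collapse_act g (collapse_map_fun x).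
Proof.
case: x => [x|] //=; rewrite -collapse_nat -smap_nat /collapse_fun.
case: (@insubP _ _ _ (act g (val x))) => [y _ /= -> //|].
by move=> Bx; rewrite /= insubN.
Qed.

Definition collapse_map : smap (collapse (sub_preim f B)) (collapse B) :=
  @Smap (collapse (sub_preim f B)) (collapse B)
        collapse_map_fun collapse_map_nat.

Lemma collapse_map_proj n (x : X n) :
  collapse_map n (collapse_proj _ n x) = collapse_proj B n (f n x).
Proof.
rewrite /= /collapse_map_fun /collapse_fun.
case: (@insubP _ _ _ x) => [y _ /= -> //|Bx].
by rewrite /= insubN.
Qed.
End CollapseMap.

(* The inclusion of the pushouts along the face of [std n] spanned by [J]; used
   only when this face is contained in the horn. *)
Definition collapsed_horn_incl n (i : 'I_n.+1) (J : seq nat) :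
  smap (collapse (sub_preim (horn_incl i) (face n J))) (collapse (face n J)) :=
  collapse_map (horn_incl i) (face n J).

Record scaled := Scaled {
  scaled_sset :> sset;
  thin : scaled_sset 2 -> Prop;
  thin_degenerate : forall x : scaled_sset 2, degenerate x -> thin x }.

Record scaled_map (X Y : scaled) := ScaledMap {
  scaled_smap :> smap X Y;
  scaled_thin : forall x : X 2, thin x -> thin (scaled_smap 2 x) }.

(* [(X, T)]: the thin triangles are those of [T] and the degenerate ones. *)
Definition scale (X : sset) (T : X 2 -> Prop) : scaled :=
  @Scaled X (fun x => T x \/ degenerate x) (fun x dx => or_intror dx).

(* [(L, T_|L)] -> [(X, T)], for [i : L -> X] an inclusion. *)
Definition scale_incl (L X : sset) (i : smap L X) (T : X 2 -> Prop) :
  scaled_map (scale (fun x => T (i 2 x))) (scale T).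
Proof.
by exists i => x [Tx|dx]; [left | right; apply: degenerate_map].
Defined.

Definition scale_add (X : sset) (T T' : X 2 -> Prop) :
  scaled_map (scale T) (scale (fun x => T x \/ T' x)).
Proof. by exists (smap_id X) => x [Tx|dx]; [left; left | right]. Defined.

Definition collapse_triangles (X : sset) (A : subsset X) (T : X 2 -> Prop) :
    collapse A 2 -> Prop :=
  fun y => exists2 x, T x & y = collapse_proj A 2 x.

Definition commutes (A B X S : sset)
    (i : smap A B) (f : smap X S) (u : smap A X) (v : smap B S) : Prop :=
  forall n (x : A n), f n (u n x) = v n (i n x).

Definition is_lift (A B X S : sset) (i : smap A B) (f : smap X S)
    (u : smap A X) (v : smap B S) (w : smap B X) : Prop :=
  (forall n (x : A n), w n (i n x) = u n x) /\
  (forall n (y : B n), f n (w n y) = v n y).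

Definition srlp (A B : sset) (i : smap A B) (X S : sset) (f : smap X S) :=
  forall (u : smap A X) (v : smap B S), commutes i f u v ->
    exists w : smap B X, is_lift i f u v w.

Definition rlp (A B : scaled) (i : scaled_map A B)
    (X S : scaled) (f : scaled_map X S) :=
  forall (u : scaled_map A X) (v : scaled_map B S), commutes i f u v ->
    exists w : scaled_map B X, is_lift i f u v w.

Definition extension (A B : scaled) (i : scaled_map A B) (X : scaled) :=
  forall u : scaled_map A X, exists w : scaled_map B X,
    forall n (x : A n), w n (i n x) = u n x.

Definition inner_incl n (i : 'I_n.+1) :=
  scale_incl (horn_incl i) (triangles [:: [:: i.-1; nat_of_ord i; i.+1]]).

Definition saturation_incl :=
  scale_add
    (@triangles 4 [:: [:: 0; 2; 4]; [:: 1; 2; 3]; [:: 0; 1; 3];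
                      [:: 1; 3; 4]; [:: 0; 1; 2]])
    (@triangles 4 [:: [:: 0; 3; 4]; [:: 0; 1; 4]]).

Definition left_collapsed_incl n :=
  scale_incl (collapsed_horn_incl (@ord0 n) [:: 0; 1])
    (collapse_triangles (triangles [:: [:: 0; 1; n]])).

Definition right_collapsed_incl n :=
  scale_incl (collapsed_horn_incl (@ord_max n) [:: n.-1; n])
    (collapse_triangles (triangles [:: [:: 0; n.-1; n]])).

(* For [n >= 3] the triangle 0, 1, n lies in the 0-th horn, so that restricting
   the scaling to the source of [left_collapsed_incl n] does not discard it. *)
Record infty_bicategory (X : scaled) : Prop := InftyBicategory {
  bicat_inner : forall n (i : 'I_n.+1), 0 < i < n -> extension (inner_incl i) X;
  bicat_saturation : extension saturation_incl X;
  bicat_left : forall n, 2 < n -> extension (left_collapsed_incl n) X }.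

Record weak_fibration (X S : scaled) (f : scaled_map X S) : Prop :=
  WeakFibration {
    weak_inner : forall n (i : 'I_n.+1), 0 < i < n -> rlp (inner_incl i) f;
    weak_left : forall n, 1 < n -> rlp (left_collapsed_incl n) f;
    weak_right : forall n, 1 < n -> rlp (right_collapsed_incl n) f }.

Record outer_fibration (X S : scaled) (f : scaled_map X S) : Prop :=
  OuterFibration {
    outer_weak : weak_fibration f;
    outer_thin : forall x : X 2, thin x <-> thin (f 2 x);
    outer_left : forall n, 1 < n ->
      srlp (collapsed_horn_incl (@ord0 n) [:: 0; 1]) f;
    outer_right : forall n, 1 < n ->
      srlp (collapsed_horn_incl (@ord_max n) [:: n.-1; n]) f }.

Definition lifts_last_horns (T : forall n, std n 2 -> Prop)
    (X S : scaled) (f : scaled_map X S) (e : X 1) : Prop :=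
  forall n, 1 < n ->
  let i := scale_incl (horn_incl (@ord_max n)) (T n) in
  forall (u : scaled_map (scale (fun x => T n (horn_incl ord_max 2 x))) X)
         (v : scaled_map (scale (T n)) S),
    commutes i f u v ->
    (forall d : sub_sset (horn (@ord_max n)) 1,
       vertices (horn_incl ord_max 1 d) = [:: n.-1; n] -> u 1 d = e) ->
    exists w : scaled_map (scale (T n)) X, is_lift i f u v w.

Definition cartesian :=
  lifts_last_horns (fun n => triangles [:: [:: 0; n.-1; n]]).

(* [scale] already makes the degenerate triangles thin. *)
Definition weakly_cartesian :=
  lifts_last_horns (fun n => contains_edge n.-1 n).

Definition strongly_cartesian :=
  lifts_last_horns (fun n _ => False).

(* Main.v *)
Require Import Defs.
From mathcomp Require Import all_boot zify.
Set Implicit Arguments.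
Unset Strict Implicit.
Unset Printing Implicit Defensive.

(** Write [n] for the dimension of the horn to be filled and [e] for its last
edge. Cartesian edges are weakly cartesian and, when [f] detects thin triangles,
strongly cartesian edges are cartesian: in both cases the triangles whose
thinness has to be recovered lie in the horn, or are thin because their images
are, or the two scalings agree on them. So everything follows from one
construction, [lift_last_horn], which fills a last horn on a weakly cartesian
edge although the triangles [(i, n-1, n)] are not thin.

Such a triangle is a 2-cell from the edge [(i, n)] to the composite of
[(i, n-1)] with [e]. The idea is to separate the 2-cell from the composition:
insert a vertex [n'] between [n-1] and [n], with [(n-1, n') = e] and with
[(n', n)] degenerate. In the resulting simplex of dimension [n+1] the triangles
[(i, n-1, n')] are chosen thin and [(i, n', n)] carries the 2-cell. The
faces [J + (n-1, n')] and [J + (n-1, n', n)], where [J] is a proper subset of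
the vertices below [n-1], are filled in [E] by inner horns at [n-1]
([extend_over_stage]); in [B], where the [n]-simplex is given, the same step
also handles the full [J] ([extend_over_low]), and gives a simplex of dimension
[n+1] in [B] over which to lift. The rest of it is lifted by three horns
([lift_last_horn]):
- the face missing [n-1] is a last horn whose last edge is degenerate, and lifts
  against the inclusions with a collapsed edge;
- the face missing [n] is a last horn on [e] whose triangles on [e] are thin, and
  lifts because [e] is weakly cartesian;
- the whole simplex is then an inner horn at [n'], whose triangle [(n-1, n', n)]
  is degenerate.
The face missing [n'] of the result is the lift sought.

For an outer fibration the first of these lifts asks for no thinness, and so
weakly cartesian edges are strongly cartesian. For a weak fibration
[(0, n', n)] has to be thin; this follows from the thinness of
[(0, n-1, n)] and [(0, n-1, n')] by the saturation axiom
([thin_of_saturation]), as soon as [n] is at least 3, when [(0, n-1, n)] belongs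
to the horn. For [n = 2] the conditions defining cartesian and weakly cartesian
edges are the same.

A map defined on a subcomplex of a standard simplex is encoded as a function on
all its simplices, which is natural on those whose vertex set lies in a
down-closed family of sets ([natural_on]). Extending it along the filler of a
horn is then a definition by cases ([glue_face]), and the successive
subcomplexes need no dependent types. *)

(** * Monotone maps and their vertex sets *)

Definition vimage m n (x : ordmap m n) : {set 'I_n.+1} := x @: setT.

Lemma mem_vimage m n (x : ordmap m n) i : x i \in vimage x.
Proof. exact: imset_f. Qed.

Lemma vimageP m n (x : ordmap m n) (S : {set 'I_n.+1}) :
  reflect (forall i, x i \in S) (vimage x \subset S).
Proof.
apply: (iffP subsetP) => [xS i|xS _ /imsetP[i _ ->] //].
exact/xS/mem_vimage.
Qed.

Lemma vimage_comp m p n (x : ordmap p n) (g : ordmap m p) :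
  vimage (ordcomp x g) \subset vimage x.
Proof. by apply/vimageP=> i; rewrite ordcompE mem_vimage. Qed.

Lemma ordcompA m p q n (x : ordmap q n) (g : ordmap p q) (h : ordmap m p) :
  ordcomp x (ordcomp g h) = ordcomp (ordcomp x g) h.
Proof. by apply: ordmap_eq => i; rewrite !ordcompE. Qed.

Lemma exists_ordmap m n (h : 'I_m.+1 -> 'I_n.+1) :
  (forall i j : 'I_m.+1, i <= j -> h i <= h j) ->
  exists g : ordmap m n, g =1 h.
Proof.
move=> hh.
have g_mono : monotone [ffun i => h i].
  apply/forallP=> i; apply/forallP=> j; apply/implyP=> ij.
  by rewrite !ffunE hh.
by exists (Ordmap g_mono) => i; rewrite ffunE.
Qed.

Lemma ltn_ordmap m n (d : ordmap m n) (i j : 'I_m.+1) :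
  injective d -> (d i < d j) = (i < j).
Proof.
move=> dI; case: (ltngtP i j) => [ij|ji|/val_inj ->]; last by rewrite ltnn.
  rewrite ltn_neqAle ordmapP ?(ltnW ij) // andbT val_eqE (inj_eq dI) -val_eqE.
  by rewrite neq_ltn ij.
by apply/negbTE; rewrite -leqNgt ordmapP // ltnW.
Qed.

(** The retraction sends [x] to the last index whose image does not exceed [x]. *)
Lemma ordmap_retraction m n (d : ordmap m n) : injective d ->
  exists r : ordmap n m, forall i, r (d i) = i.
Proof.
move=> dI; pose h (x : 'I_n.+1) := \max_(i < m.+1 | d i <= x) (i : nat).
have h_lt x : h x < m.+1 by apply/bigmax_leqP=> i _; rewrite -ltnS.
have [x y xy|r rE] := @exists_ordmap n m (fun x => Ordinal (h_lt x)).
  apply/bigmax_leqP=> i dix.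
  by apply: leq_bigmax_cond; apply: leq_trans xy.
exists r => i; rewrite rE; apply/val_inj/eqP; rewrite eqn_leq /=.
rewrite leq_bigmax_cond // andbT; apply/bigmax_leqP=> j.
by rewrite leqNgt ltn_ordmap // -leqNgt.
Qed.

Lemma face_embedding n m (S : {set 'I_n.+1}) : #|S| = m.+1 ->
  exists2 d : ordmap m n, injective d & vimage d = S.
Proof.
move=> cS; pose s := enum S.
have ss : size s = m.+1 by rewrite -cardE.
have s_sorted : sorted ltn (map val s).
  rewrite /s -[enum _](eq_filter (mem_enum _)).
  rewrite -(eq_filter (mem_map val_inj _)) -filter_map.
  by rewrite (sorted_filter ltn_trans) // unlock val_ord_enum iota_ltn_sorted.
have s_lt (i j : 'I_m.+1) : i < j -> nth ord0 s i < nth ord0 s j.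
  move=> ij; rewrite -!(nth_map _ 0 val) ?ss //.
  by apply: (sorted_ltn_nth ltn_trans) => //; rewrite inE size_map ss.
have [i j|d dE] := @exists_ordmap m n (fun i => nth ord0 s i).
  by rewrite leq_eqVlt => /predU1P[/val_inj -> //|/s_lt/ltnW].
exists d.
  move=> i j; rewrite !dE => /eqP.
  by rewrite nth_uniq ?ss ?enum_uniq // => /eqP/val_inj.
apply/eqP; rewrite eqEsubset; apply/andP; split; apply/subsetP=> x.
  by case/imsetP=> i _ ->; rewrite dE -mem_enum mem_nth ?ss.
rewrite -mem_enum => /(nthP ord0)[i]; rewrite -/s ss => lt_i <-.
by apply/imsetP; exists (Ordinal lt_i) => //; rewrite dE.
Qed.

Lemma face_factor p m n (d : ordmap m n) (x : ordmap p n) : injective d ->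
  vimage x \subset vimage d -> exists y : ordmap p m, x = ordcomp d y.
Proof.
move=> /ordmap_retraction[r rd] /vimageP xd; exists (ordcomp r x).
apply: ordmap_eq => i; rewrite !ordcompE.
by have /imsetP[k _ ->] := xd i; rewrite rd.
Qed.

Lemma vertices2E n (x : ordmap 2 n) :
  vertices (x : std n 2) =
    [:: nat_of_ord (x ord0); nat_of_ord (x (inord 1)); nat_of_ord (x ord_max)].
Proof.
rewrite /vertices /image_mem enum_ordSl enum_ordSl enum_ordSl enum_ord0 /=.
by congr [:: _; nat_of_ord (x _); nat_of_ord (x _)]; apply/val_inj; rewrite /= ?inordK.
Qed.

Lemma ord3P (i : 'I_3) : [\/ i = ord0, i = inord 1 | i = ord_max].
Proof.
case: i => [[|[|[|//]]] lt_i]; [constructor 1|constructor 2|constructor 3];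
  by apply/val_inj; rewrite /= ?inordK.
Qed.

Lemma vertices2P n (x : ordmap 2 n) (p v q : nat) :
  vertices (x : std n 2) = [:: p; v; q] <->
  [/\ x ord0 = p :> nat, x (inord 1) = v :> nat & x ord_max = q :> nat].
Proof. by rewrite vertices2E; split=> [[-> -> ->]|[-> -> ->]]. Qed.

(** The dichotomy expresses that the scaling of weakly cartesian edges only
concerns the triangles [(i, n-1, n)], the others being degenerate. *)
Lemma contains_last_edge n (y : ordmap 2 n.+2) :
  contains_edge n.+1 n.+2 (y : std n.+2 2) ->
  [/\ y ord0 < n.+1, y (inord 1) = n.+1 :> nat & y ord_max = n.+2 :> nat]
  \/ ~ injective y.
Proof.
case=> h; rewrite /vertices /image_mem enum_ordSl enum_ordSl enum_ord0 /=.
move=> [h0 h1]; rewrite !ffunE in h0 h1.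
have y01 : y ord0 <= y (inord 1) by apply: ordmapP.
have y12 : y (inord 1) <= y ord_max by apply: ordmapP; rewrite /= inordK.
have y2 := ltn_ord (y ord_max).
have [y0|y0] := ltnP (y ord0) n.+1.
  left; case: (ord3P (h ord0)) (ord3P (h (lift ord0 ord0))) h0 h1 => -> [] -> h0 h1;
  split => //; lia.
right=> yI.
have d01 : y ord0 <> y (inord 1) :> nat.
  by move/ord_inj/yI/(congr1 (@nat_of_ord _)); rewrite inordK.
have d12 : y (inord 1) <> y ord_max :> nat.
  by move/ord_inj/yI/(congr1 (@nat_of_ord _)); rewrite inordK.
lia.
Qed.

Lemma triangle_contains_edge l (y : std l.+2 2) :
  triangles [:: [:: 0; l.+1; l.+2]] y -> contains_edge l.+1 l.+2 y.
Proof.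
rewrite /triangles inE => /eqP/vertices2P[_ y1 y2].
have [i' j|h hE] := @exists_ordmap 1 2 (fun i => inord i.+1).
  by have i2 := ltn_ord i'; have j2 := ltn_ord j; rewrite !inordK; lia.
exists h; rewrite /vertices /image_mem enum_ordSl enum_ordSl enum_ord0 /=.
have h1 : inord (bump 0 0).+1 = ord_max :> 'I_3 by apply: ord_inj; rewrite inordK.
by rewrite !ffunE !hE /= y1 h1 y2.
Qed.

(** * Partial maps on a simplex, and gluing along a horn *)

Definition down_closed n (F : pred {set 'I_n.+1}) :=
  forall S T : {set 'I_n.+1}, S \subset T -> F T -> F S.

(** Only the values on the simplices whose vertex set lies in [F] are meaningful:
for down-closed [F] they form a map from the subcomplex spanned by [F]. *)
Definition natural_on (X : sset) n (F : pred {set 'I_n.+1})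
    (u : forall m, ordmap m n -> X m) :=
  forall m p (g : ordmap m p) (x : ordmap p n),
    F (vimage x) -> u m (ordcomp x g) = act g (u p x).

Lemma natural_degenerate (X : sset) n (F : pred {set 'I_n.+1})
    (u : forall m, ordmap m n -> X m) m (x : ordmap m n) :
  natural_on F u -> F (vimage x) -> ~ injective x -> degenerate (u m x).
Proof.
move=> uF Fx xI; have: #|vimage x| <= m.
  rewrite -ltnS ltn_neqAle -{2}[m.+1]card_ord -cardsT leq_imset_card andbT.
  apply/negP=> /eqP cx; apply: xI; apply: in2T.
  have /imset_injP : #|x @: setT| == #|[set: 'I_m.+1]|.
    by rewrite -/(vimage x) cx cardsT card_ord.
  by move=> xI i j _ _; apply: xI; rewrite inE.
case cx: #|vimage x| => [|p] pm.
  by move: (cards0_eq cx) (mem_vimage x ord0) => ->; rewrite inE.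
have [d dI dx] := face_embedding cx.
have [|y xE] := @face_factor _ _ _ d x dI; first by rewrite dx.
by exists p, y, (u p d); rewrite xE uF ?dx.
Qed.

Lemma smap_degenerate n (X : sset) (V : smap (std n) X) m (x : ordmap m n) :
  ~ injective x -> degenerate (V m x).
Proof.
apply: (@natural_degenerate _ _ xpredT (fun p (y : ordmap p n) => V p y)) => //.
by move=> p q g y _; rewrite -smap_nat.
Qed.

Lemma std_degenerate n m (x : std n m) : ~ injective (x : ordmap m n) -> degenerate x.
Proof. exact: (smap_degenerate (smap_id (std n))). Qed.

Lemma degenerate_act n (X : sset) (t : X n) m (x : ordmap m n) :
  ~ injective x -> degenerate (act x t).
Proof.
apply: (@natural_degenerate _ _ xpredT (fun p (y : ordmap p n) => act y t)) => //.
by move=> p q g y _; rewrite act_comp.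
Qed.

Lemma ordcomp_inj m n p (d : ordmap n p) (x : ordmap m n) :
  injective (ordcomp d x) -> injective x.
Proof. by move=> dxI i j xij; apply: dxI; rewrite !ordcompE xij. Qed.

Definition scaled_map_of (X : sset) (Y : scaled) (T : X 2 -> Prop) (u : smap X Y)
  (uT : forall x, T x -> thin (u 2 x)) : scaled_map (scale T) Y.
Proof.
by exists u => x [/uT //|/(degenerate_map u)/thin_degenerate //].
Defined.

(** The subcomplex spanned by [F] meets the face [d] in its [k]-th horn. *)
Definition horn_shaped n (F : pred {set 'I_n.+1}) m (d : ordmap m n)
    (k : 'I_m.+1) :=
  ~~ F (vimage d :\ d k) /\ forall j, j != k -> F (vimage d :\ d j).

Definition add_face n (F : pred {set 'I_n.+1}) (S : {set 'I_n.+1}) :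
  pred {set 'I_n.+1} := fun T => F T || (T \subset S).

Lemma horn_shapedP n (F : pred {set 'I_n.+1}) m (d : ordmap m n) k :
  down_closed F -> injective d -> horn_shaped F d k ->
  forall p (y : ordmap p m),
    smem (horn k) (y : std m p) = F (vimage (ordcomp d y)).
Proof.
move=> Fdc dI [nFk Fj] p y; apply/existsP/idP => [[j /andP[jk /forallP yj]]|Fy].
  apply: Fdc (Fj j jk); apply/vimageP=> i.
  by rewrite ordcompE !inE mem_vimage (inj_eq dI) yj.
apply/existsP; apply: contraNT nFk; rewrite negb_exists => /forallP yk.
apply: Fdc Fy; apply/subsetP=> x; rewrite !inE => /andP[xk].
case/imsetP=> j _ xE; move: (yk j); rewrite {}xE in xk *.
rewrite (inj_eq dI) in xk; rewrite xk /= negb_forall => /existsP[i].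
by rewrite negbK => /eqP <-; rewrite -ordcompE mem_vimage.
Qed.

(** The pushout along a horn: a map [u] on the subcomplex spanned by [F] and a
filler [w] of its restriction to the horn of [d] glue to a map on the union with
the face. They agree where both are defined because a simplex of the face
belongs to [F] exactly when it lies in the horn. *)
Lemma glue_face (X : sset) n (F : pred {set 'I_n.+1})
    (u : forall m, ordmap m n -> X m) m (d : ordmap m n) (k : 'I_m.+1) :
  down_closed F -> natural_on F u -> injective d -> horn_shaped F d k ->
  exists2 ud : smap (sub_sset (horn k)) X,
    forall p y, ud p y = u p (ordcomp d (val y)) &
    forall w : smap (std m) X,
      (forall p y, w p (horn_incl k p y) = ud p y) ->
      exists u', [/\ natural_on (add_face F (vimage d)) u',
        forall p (x : ordmap p n), F (vimage x) -> u' p x = u p x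
      & forall p (y : ordmap p m), u' p (ordcomp d y) = w p y].
Proof.
move=> Fdc uF dI hF; have hP := horn_shapedP Fdc dI hF.
have ud_nat p q (g : ordmap p q) (y : sub_sset (horn k) q) :
    u p (ordcomp d (val (act g y))) = act g (u q (ordcomp d (val y))).
  by rewrite /= ordcompA uF // -hP (valP y).
pose ud := @Smap (sub_sset (horn k)) X (fun p y => u p (ordcomp d (val y))) ud_nat.
exists ud => // w wE.
have wF p (y : ordmap p m) : F (vimage (ordcomp d y)) ->
    w p y = u p (ordcomp d y).
  by rewrite -hP => Hy; have := wE p (exist _ (y : std m p) Hy).
have [r rd] := ordmap_retraction dI.
have rdE p (y : ordmap p m) : ordcomp r (ordcomp d y) = y.
  by apply: ordmap_eq => i; rewrite !ordcompE rd.
pose u' p (x : ordmap p n) : X p :=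
  if ~~ F (vimage x) && (vimage x \subset vimage d)
  then w p (ordcomp r x) else u p x.
have u'F p (x : ordmap p n) : F (vimage x) -> u' p x = u p x.
  by rewrite /u' => ->.
have u'd p (y : ordmap p m) : u' p (ordcomp d y) = w p y.
  case Fy: (F (vimage (ordcomp d y))); first by rewrite u'F ?wF.
  by rewrite /u' Fy vimage_comp rdE.
exists u'; split=> // p q g x; case: (boolP (F (vimage x))) => [Fx _|nFx].
  by rewrite !u'F ?uF //; apply: Fdc Fx; apply: vimage_comp.
rewrite /add_face (negbTE nFx) /= => /(face_factor dI)[y ->].
by rewrite -ordcompA !u'd -smap_nat.
Qed.

Lemma add_face_down n (F : pred {set 'I_n.+1}) S :
  down_closed F -> down_closed (add_face F S).
Proof.
move=> Fdc U V UV /orP[FV|VS]; apply/orP; [left|right].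
  exact: Fdc UV FV.
exact: subset_trans VS.
Qed.

Lemma natural_sub (X : sset) n (F G : pred {set 'I_n.+1})
    (u : forall m, ordmap m n -> X m) :
  (forall S, G S -> F S) -> natural_on F u -> natural_on G u.
Proof. by move=> GF uF m p g x /GF; apply: uF. Qed.

(** * Filling an inner horn on a set of vertices *)

Definition inner_extension (X : scaled) :=
  forall n (i : 'I_n.+1), 0 < i < n -> extension (inner_incl i) X.

(** In the face spanned by [S], the vertices [p], [v], [q] are consecutive, so that
[(p, v, q)] is the triangle required to be thin by the [v]-th horn of that face;
when [S] has no other vertex this triangle is not in the horn, and the filler
makes it thin. *)
Lemma inner_fill (X : scaled) n (F : pred {set 'I_n.+1})
    (u : forall m, ordmap m n -> X m) (S : {set 'I_n.+1}) (p v q : 'I_n.+1) :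
  inner_extension X -> down_closed F -> natural_on F u ->
  [/\ p \in S, v \in S & q \in S] -> p < v < q ->
  (forall s, s \in S -> p < s < q -> s = v) ->
  ~~ F (S :\ v) -> (forall j, j \in S -> j != v -> F (S :\ j)) ->
  (forall x : ordmap 2 n,
     vertices (x : std n 2) = [:: nat_of_ord p; nat_of_ord v; nat_of_ord q] ->
     F (vimage x) -> thin (u 2 x)) ->
  exists u' : forall m, ordmap m n -> X m,
    [/\ natural_on (add_face F S) u',
        forall m (x : ordmap m n), F (vimage x) -> u' m x = u m x
      & forall x : ordmap 2 n,
          vertices (x : std n 2) = [:: nat_of_ord p; nat_of_ord v; nat_of_ord q] ->
          thin (u' 2 x)].
Proof.
move=> hX Fdc uF [pS vS qS] /andP[pv vq] pvq nFv Fj thin_u.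
case cS: #|S| => [|m]; first by move: (cards0_eq cS) pS => ->; rewrite inE.
have [d dI dS] := face_embedding cS.
have [/imsetP[kp _ pE] /imsetP[k _ vE] /imsetP[kq _ qE]] :
  [/\ p \in d @: setT, v \in d @: setT & q \in d @: setT] by rewrite -/(vimage d) dS.
have kpk : kp < k by rewrite -(ltn_ordmap _ _ dI) -pE -vE.
have kkq : k < kq by rewrite -(ltn_ordmap _ _ dI) -vE -qE.
have k0m : 0 < k < m by have := ltn_ord kq; lia.
have hF : horn_shaped F d k.
  rewrite /horn_shaped dS -vE; split=> // j jk; apply: Fj.
    by rewrite -dS mem_vimage.
  by rewrite vE (inj_eq dI).
have [ud udE glue] := glue_face Fdc uF dI hF.
have dTri (y : ordmap 2 m) : vertices (y : std m 2) = [:: k.-1; nat_of_ord k; k.+1] <->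
    vertices (ordcomp d y : std n 2) = [:: nat_of_ord p; nat_of_ord v; nat_of_ord q].
  rewrite !vertices2P !ordcompE.
  have kpE : kp = k.-1 :> nat.
    apply/eqP; rewrite eqn_leq -ltnS prednK ?kpk; last by case/andP: k0m.
    rewrite leqNgt; apply/negP=> lt.
    have lt1 : k.-1 < m.+1 by lia.
    suff E : d (Ordinal lt1) = v by move: E; rewrite vE => /dI/(congr1 val) /=; lia.
    apply: pvq; first by rewrite -dS mem_vimage.
    by rewrite pE qE !ltn_ordmap //=; lia.
  have kqE : kq = k.+1 :> nat.
    apply/eqP; rewrite eqn_leq kkq andbT leqNgt; apply/negP=> lt.
    have lt1 : k.+1 < m.+1 by lia.
    suff E : d (Ordinal lt1) = v by move: E; rewrite vE => /dI/(congr1 val) /=; lia.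
    apply: pvq; first by rewrite -dS mem_vimage.
    by rewrite pE qE !ltn_ordmap //=; lia.
  rewrite -kpE -kqE pE vE qE.
  by split=> -[] => [/val_inj -> /val_inj -> /val_inj ->|
    /val_inj/dI -> /val_inj/dI -> /val_inj/dI ->].
have udT (y : sub_sset (horn k) 2) :
    triangles [:: [:: k.-1; nat_of_ord k; k.+1]] (horn_incl k 2 y) -> thin (ud 2 y).
  rewrite /triangles inE => /eqP/dTri dy; rewrite udE; apply: thin_u => //.
  by rewrite -(horn_shapedP Fdc dI hF) (valP y).
have [w wE] := hX m k k0m (scaled_map_of udT).
have [u' [u'nat u'F u'd]] := glue w wE.
exists u'; split=> //; first by rewrite -dS.
move=> x xE; have [|y yE] := @face_factor _ _ _ d x dI.
  rewrite dS; apply/vimageP=> i.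
  case/vertices2P: xE => /val_inj x0 /val_inj x1 /val_inj x2.
  case: (ord3P i) => ->.
  - by rewrite x0.
  - by rewrite x1.
  by rewrite x2.
rewrite yE u'd; apply: (@scaled_thin _ _ w y); left; rewrite /triangles inE; apply/eqP.
by apply/dTri; rewrite -yE.
Qed.

(** * Relative filling *)

Definition smap_comp (X Y Z : sset) (g : smap Y Z) (f : smap X Y) : smap X Z.
Proof.
by exists (fun m x => g m (f m x)) => m p h x; rewrite !smap_nat.
Defined.

Definition std_map m n (d : ordmap m n) : smap (std m) (std n) :=
  @Smap (std m) (std n) (fun _ y => ordcomp d y)
    (fun _ _ g x => ordcompA d x g).

Fact coface_mono n (j : 'I_n.+2) : monotone [ffun i : 'I_n.+1 => lift j i].
Proof.
apply/forallP=> i; apply/forallP=> k; apply/implyP=> ik.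
by rewrite !ffunE /= leq_bump2.
Qed.
Definition coface n (j : 'I_n.+2) : ordmap n n.+1 := Ordmap (coface_mono j).

Lemma cofaceE n (j : 'I_n.+2) i : coface j i = lift j i.
Proof. by rewrite ffunE. Qed.

Lemma coface_inj n (j : 'I_n.+2) : injective (coface j).
Proof. by move=> i k; rewrite !cofaceE => /lift_inj. Qed.

Lemma vimage_coface n (j : 'I_n.+2) : vimage (coface j) = [set~ j].
Proof.
apply/setP=> x; rewrite !inE; apply/imsetP/idP=> [[i _ ->]|xj].
  by rewrite cofaceE eq_sym neq_lift.
case: (unliftP j x) xj => [i ->|->]; last by rewrite eqxx.
by exists i; rewrite // cofaceE.
Qed.

Lemma vimage_id n : vimage (ordid n) = setT.
Proof. by apply/setP=> x; rewrite inE; have := mem_vimage (ordid n) x; rewrite ffunE. Qed.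

Lemma ordid_inj n : injective (ordid n).
Proof. by move=> i j; rewrite !ffunE. Qed.

Lemma ordcomp_id m n (x : ordmap m n) : ordcomp (ordid n) x = x.
Proof. by apply: ordmap_eq => i; rewrite ordcompE ffunE. Qed.

Definition horn_family n (i : 'I_n.+1) : pred {set 'I_n.+1} :=
  fun S => [exists j, (j != i) && (j \notin S)].

Lemma horn_familyE m n (i : 'I_n.+1) (x : ordmap m n) :
  smem (horn i) (x : std n m) = horn_family i (vimage x).
Proof.
apply: eq_existsb => j; congr (_ && _); apply/forallP/idP.
  by move=> xj; apply/imsetP=> -[k _ /esym/eqP]; rewrite (negbTE (xj k)).
by move=> jx k; apply: contraNneq jx => <-; apply: mem_vimage.
Qed.

(** Simplices outside the horn are sent to constant simplices at the first vertex
of [x0]. *)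
Lemma horn_extend n (i : 'I_n.+1) (X : sset) q (x0 : X q)
    (u : smap (sub_sset (horn i)) X) :
  exists2 ut : forall m, ordmap m n -> X m, natural_on (horn_family i) ut &
    forall m (y : sub_sset (horn i) m), ut m (val y) = u m y.
Proof.
have cst m : {g : ordmap m q | g =1 fun=> ord0}.
  suff g_mono : monotone [ffun _ : 'I_m.+1 => ord0 : 'I_q.+1].
    by exists (Ordmap g_mono) => j; rewrite ffunE.
  by apply/forallP=> j; apply/forallP=> k; rewrite !ffunE leqnn implybT.
pose ut m (x : ordmap m n) : X m :=
  if insub (x : std n m) is Some y then u m y else act (sval (cst m)) x0.
have utE m (y : sub_sset (horn i) m) : ut m (val y) = u m y.
  by rewrite /ut valK.
exists ut => // m p g x; rewrite -horn_familyE => xi.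
pose y : sub_sset (horn i) p := exist _ (x : std n p) xi.
by rewrite (utE p y) -smap_nat -utE.
Qed.

Lemma lift_face (E B : sset) (f : smap E B) n (F : pred {set 'I_n.+1})
    (u : forall m, ordmap m n -> E m) (V : smap (std n) B)
    m (d : ordmap m n) (k : 'I_m.+1) :
  down_closed F -> natural_on F u ->
  (forall p (x : ordmap p n), F (vimage x) -> f p (u p x) = V p x) ->
  injective d -> horn_shaped F d k ->
  let Vd := smap_comp V (std_map d) in
  exists ud : smap (sub_sset (horn k)) E,
    [/\ forall p y, ud p y = u p (ordcomp d (val y)),
        commutes (horn_incl k) f ud Vd
      & forall w : smap (std m) E, is_lift (horn_incl k) f ud Vd w ->
        exists u', [/\ natural_on (add_face F (vimage d)) u',
          forall p (x : ordmap p n), F (vimage x) -> u' p x = u p x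
        & forall p (x : ordmap p n), add_face F (vimage d) (vimage x) ->
            f p (u' p x) = V p x]].
Proof.
move=> Fdc uF fu dI hF Vd; have [ud udE glue] := glue_face Fdc uF dI hF.
exists ud; split=> // [p y|w [wu fw]].
  rewrite udE /= fu // -(horn_shapedP Fdc dI hF); exact: (valP y).
have [u' [u'nat u'F u'd]] := glue w wu; exists u'; split=> // p x.
case/orP=> [Fx|/(face_factor dI)[y ->]]; first by rewrite u'F ?fu.
by rewrite u'd fw.
Qed.

(** * Two consequences of the axioms *)

(** The codegeneracy repeating the vertex 1 turns the triangle [(0, 3, 4)] of the
saturation axiom into [(0, 2, 3)], and its five hypotheses into the three faces
of [t] named below and degenerate triangles. *)
Lemma thin_of_saturation (X : scaled) (t : X 3) : extension saturation_incl X ->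
  (forall g : ordmap 2 3, vertices (g : std 3 2) \in [:: [:: 0; 1; 2]; [:: 0; 1; 3];
     [:: 1; 2; 3]] -> thin (act g t)) ->
  forall g : ordmap 2 3, vertices (g : std 3 2) = [:: 0; 2; 3] -> thin (act g t).
Proof.
move=> hX thin_t g gE.
have [i j|s sE] :=
  @exists_ordmap 4 3 (fun i => inord (if i < 2 then i : nat else i.-1)).
  case: i => [[|[|[|[|[|//]]]]] ?]; case: j => [[|[|[|[|[|//]]]]] ?];
    by rewrite /= ?inordK.
have sN i : s i = (if i < 2 then i : nat else i.-1) :> nat.
  by rewrite sE inordK //; case: i => [[|[|[|[|[|//]]]]] ?].
have U_nat m p (h : ordmap m p) (x : std 4 p) :
    act (ordcomp s (act h x)) t = act h (act (ordcomp s x) t).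
  by rewrite /= ordcompA act_comp.
pose U := @Smap (std 4) X (fun m x => act (ordcomp s x) t) U_nat.
have U_thin (x : std 4 2) :
    triangles [:: [:: 0; 2; 4]; [:: 1; 2; 3]; [:: 0; 1; 3]; [:: 1; 3; 4];
                  [:: 0; 1; 2]] x -> thin (U 2 x).
  rewrite /triangles !inE => xT; pose y := ordcomp s x.
  have yE i : y i = (if x i < 2 then x i : nat else (x i).-1) :> nat.
    by rewrite ordcompE sN.
  have deg i j : i != j -> y i = y j :> nat -> thin (U 2 x).
    move=> ij /val_inj yij; apply/thin_degenerate/(degenerate_act t) => yI.
    by rewrite (yI _ _ yij) eqxx in ij.
  move: xT => /or4P[| | |/orP[]] /eqP/vertices2P[x0 x1 x2].
  - apply: thin_t; suff -> : vertices (y : std 3 2) = [:: 0; 1; 3] by [].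
    by apply/vertices2P; rewrite !yE x0 x1 x2.
  - by apply: (deg ord0 (inord 1)); rewrite -?val_eqE /= ?inordK // !yE x0 x1.
  - apply: thin_t; suff -> : vertices (y : std 3 2) = [:: 0; 1; 2] by [].
    by apply/vertices2P; rewrite !yE x0 x1 x2.
  - apply: thin_t; suff -> : vertices (y : std 3 2) = [:: 1; 2; 3] by [].
    by apply/vertices2P; rewrite !yE x0 x1 x2.
  by apply: (deg (inord 1) ord_max); rewrite -?val_eqE /= ?inordK // !yE x1 x2.
have [W WE] := hX (scaled_map_of U_thin).
have [i j|h hE] :=
  @exists_ordmap 2 4 (fun i => inord (if i == 0 :> nat then 0 else i.+2)).
  by case: i => [[|[|[|//]]] ?]; case: j => [[|[|[|//]]] ?]; rewrite /= ?inordK.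
have hN i : h i = (if i == 0 :> nat then 0 else i.+2) :> nat.
  by rewrite hE inordK //; case: i => [[|[|[|//]]] ?].
have <- : ordcomp s h = g.
  case/vertices2P: gE => g0 g1 g2; apply: ordmap_eq => i; apply/val_inj.
  rewrite /= ordcompE sN hN.
  by case: (ord3P i) => ->; rewrite ?g0 ?g1 ?g2 /= ?inordK.
have := @scaled_thin _ _ W h; rewrite (WE 2 h); apply; left; right.
by rewrite /triangles !inE (_ : vertices _ = [:: 0; 3; 4]) //;
   apply/vertices2P; rewrite !hN /= ?inordK.
Qed.

(** A map is defined on a simplex, or on a horn, with a collapsed face as soon as
it is constant on that face; so collapsed horns can be filled without mentioning
the quotient. *)
Section Collapsed.

Variables (n : nat) (i : 'I_n.+1) (L : seq nat) (X S : sset) (f : smap X S).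
Variables (u : smap (sub_sset (horn i)) X) (v : smap (std n) S) (p : smap (std 0) X).

Lemma collapsed_problem :
  (forall m (x : std n m), smem (face n L) x -> smem (horn i) x) ->
  commutes (horn_incl i) f u v ->
  (forall m (x : sub_sset (horn i) m) t, smem (face n L) (val x) -> u m x = p m t) ->
  exists uc vc, [/\ commutes (collapsed_horn_incl i L) f uc vc,
    forall m x, uc m (collapse_proj _ m x) = u m x,
    forall m x, vc m (collapse_proj (face n L) m x) = v m x
  & forall w, is_lift (collapsed_horn_incl i L) f uc vc w ->
    is_lift (horn_incl i) f u v (smap_comp w (collapse_proj (face n L)))].
Proof.
move=> faceH fu up.
have [uc [ucu ucp _]] :=
  @collapse_universal _ (sub_preim (horn_incl i) (face n L)) X u p up.
have [|vc [vcv vcp _]] := @collapse_universal _ (face n L) S v (smap_comp f p).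
  move=> m x t xL; have := fu m (exist _ x (faceH m x xL)); rewrite /= => <-.
  by rewrite (up _ _ t).
have cE m x : collapsed_horn_incl i L m (collapse_proj _ m x) =
    collapse_proj (face n L) m (horn_incl i m x).
  exact: collapse_map_proj.
exists uc, vc; split=> //.
  move=> m [x|].
    have xE : Some x = collapse_proj (sub_preim (horn_incl i) (face n L)) m (val x).
      by rewrite /= /collapse_fun valK.
    by rewrite xE ucu cE vcv fu.
  have [//|t _] := @exists_ordmap m 0 (fun=> ord0).
  rewrite -[RHS]/(vc m (collapse_pt _ m t)) vcp.
  by rewrite -[uc m None]/(uc m (collapse_pt _ m t)) ucp.
move=> w [wu fw]; split=> [m x|m y]; last by rewrite /= fw vcv.
by rewrite -ucu -wu cE.
Qed.
End Collapsed.

Lemma outer_lift n (i : 'I_n.+1) (L : seq nat) (X S : sset) (f : smap X S) :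
  (forall m (x : std n m), smem (face n L) x -> smem (horn i) x) ->
  srlp (collapsed_horn_incl i L) f ->
  forall (u : smap (sub_sset (horn i)) X) (v : smap (std n) S) (p : smap (std 0) X),
  commutes (horn_incl i) f u v ->
  (forall m (x : sub_sset (horn i) m) t, smem (face n L) (val x) -> u m x = p m t) ->
  exists w, is_lift (horn_incl i) f u v w.
Proof.
move=> faceH fL u v p fu up.
have [uc [vc [fuc _ _ lift]]] := collapsed_problem faceH fu up.
by have [w /lift] := fL uc vc fuc; exists (smap_comp w (collapse_proj (face n L))).
Qed.

Lemma weak_lift n (i : 'I_n.+1) (L : seq nat) (T : std n 2 -> Prop)
    (X S : scaled) (f : scaled_map X S) :
  (forall m (x : std n m), smem (face n L) x -> smem (horn i) x) ->
  rlp (scale_incl (collapsed_horn_incl i L) (collapse_triangles T)) f ->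
  forall (u : smap (sub_sset (horn i)) X) (v : smap (std n) S) (p : smap (std 0) X),
  commutes (horn_incl i) f u v ->
  (forall m (x : sub_sset (horn i) m) t, smem (face n L) (val x) -> u m x = p m t) ->
  (forall x : sub_sset (horn i) 2, T (val x) -> thin (u 2 x)) ->
  (forall x : std n 2, T x -> thin (v 2 x)) ->
  exists w, is_lift (horn_incl i) f u v w.
Proof.
move=> faceH fL u v p fu up uT vT.
have [uc [vc [fuc ucu vcv lift]]] := collapsed_problem faceH fu up.
have ucT (y : collapse (sub_preim (horn_incl i) (face n L)) 2) :
    collapse_triangles T (collapsed_horn_incl i L 2 y) -> thin (uc 2 y).
  case=> x Tx; case: y => [y|_].
    have yE : Some y = collapse_proj (sub_preim (horn_incl i) (face n L)) 2 (val y).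
      by rewrite /= /collapse_fun valK.
    rewrite {1}yE collapse_map_proj yE ucu /= /collapse_fun.
    rewrite (insubT (fun z : std n 2 => ~~ smem (face n L) z) (valP y)).
    case: insubP => // z _ zx [] /(congr1 val) /= yz; apply: uT.
    by have <- : x = val (val y) by rewrite -zx; apply: esym.
  have [//|g _] := @exists_ordmap 2 0 (fun=> ord0).
  apply/thin_degenerate; exists 0, g, (uc 0 None); split=> //.
  exact: (smap_nat uc g None).
have vcT (y : collapse (face n L) 2) :
    collapse_triangles T y -> thin (vc 2 y).
  by case=> x Tx ->; rewrite vcv; apply: vT.
have [w /lift wE] := fL (scaled_map_of ucT) (scaled_map_of vcT) fuc.
by exists (smap_comp w (collapse_proj (face n L))).
Qed.

(** * The simplex with a doubled last vertex *)

Section DoubledVertex.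
Variable l : nat.

(** With [n = l + 2] the dimension of the horn, the simplex of dimension [n + 1] has
the vertices [va = n - 1], [vb = n'] and [vc = n] above those of [low]: its face
missing [vb] is the original simplex. *)
Definition va : 'I_l.+4 := inord l.+1.
Definition vb : 'I_l.+4 := inord l.+2.
Definition vc : 'I_l.+4 := inord l.+3.
Lemma vaE : va = l.+1 :> nat. Proof. rewrite inordK; lia. Qed.
Lemma vbE : vb = l.+2 :> nat. Proof. rewrite inordK; lia. Qed.
Lemma vcE : vc = l.+3 :> nat. Proof. rewrite inordK; lia. Qed.

Definition low : {set 'I_l.+4} := [set x : 'I_l.+4 | x < l.+1].
Definition top : {set 'I_l.+4} := [set x : 'I_l.+4 | l < x].

Lemma in_top x : (x \in top) = [|| x == va, x == vb | x == vc].
Proof. by rewrite inE -!val_eqE /= vaE vbE vcE; have := ltn_ord x; lia. Qed.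

Lemma vertex_ltE : [/\ va < vb, va < vc & vb < vc].
Proof. by rewrite vaE vbE vcE; split; lia. Qed.

Lemma vertex_eqE : ((va == vb) = false) * ((va == vc) = false) *
  ((vb == vc) = false) * ((vb == va) = false) * ((vc == va) = false) *
  ((vc == vb) = false).
Proof. by rewrite -!val_eqE /= vaE vbE vcE; do !split; lia. Qed.

Lemma low_notin_top x : x \in low -> x \in top = false.
Proof. by rewrite !inE; lia. Qed.

Lemma notin_low (J : {set 'I_l.+4}) t :
  J \subset low -> t \in top -> t \in J = false.
Proof. by move=> Jlow; apply: contraTF => /(subsetP Jlow)/low_notin_top ->. Qed.

Lemma in_tops : [/\ va \in top, vb \in top & vc \in top].
Proof. by rewrite !in_top !eqxx !orbT. Qed.

Ltac bool_cases :=
  repeat match goal with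
  | |- context [?x == ?y] => case: (x == y)
  | |- context [?x \in ?A] => case: (x \in A) end.

(** Two inner horns at [va], both with thin triangle [(p, va, vb)] for [p] the
maximum of [J]. The first fills [J + (va, vb)], of which [J + vb] is missing; the
second fills [J + (va, vb, vc)], of which [J + (vb, vc)] is missing. *)
Lemma extend_over_face (X : scaled) (F : pred {set 'I_l.+4})
    (u : forall m, ordmap m l.+3 -> X m) (J : {set 'I_l.+4}) :
  inner_extension X -> down_closed F -> natural_on F u ->
  J != set0 -> J \subset low -> F (J :|: [set va; vc]) ->
  (forall j, j \in J -> F ((J :\ j) :|: top)) -> ~~ F (vb |: J) ->
  (forall x : ordmap 2 l.+3, x ord0 \in J -> x (inord 1) = va ->
     x ord_max = vb -> F (vimage x) -> thin (u 2 x)) ->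
  exists u' : forall m, ordmap m l.+3 -> X m,
    [/\ natural_on (add_face F (J :|: top)) u',
        forall m (x : ordmap m l.+3), F (vimage x) -> u' m x = u m x
      & forall x : ordmap 2 l.+3, x ord0 \in J -> x (inord 1) = va ->
          x ord_max = vb -> thin (u' 2 x)].
Proof.
move=> hX Fdc uF /set0Pn[j0 j0J] Jlow FJac FJtop nFJb thin_u.
have lowJ j : j \in J -> j < l.+1 by move/(subsetP Jlow); rewrite inE.
have [p pJ p_max] : exists2 p : 'I_l.+4, p \in J & forall j, j \in J -> j <= p.
  by case: (arg_maxnP (fun j : 'I_l.+4 => j : nat) j0J) => p pJ pmax; exists p.
have triS (x : ordmap 2 l.+3) : x ord0 \in J -> x (inord 1) = va -> x ord_max = vb ->
    vimage x \subset x ord0 |: [set va; vb].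
  move=> _ x1 x2; apply/vimageP=> i.
  by case: (ord3P i) => ->; rewrite ?x1 ?x2 !inE eqxx ?orbT.
have triE (x : ordmap 2 l.+3) :
    vertices (x : std _ 2) = [:: nat_of_ord p; nat_of_ord va; nat_of_ord vb] ->
    [/\ x ord0 = p, x (inord 1) = va & x ord_max = vb].
  by case/vertices2P=> /val_inj ? /val_inj ? /val_inj ?.
have pa : p < va by rewrite vaE lowJ.
have [ab _ bc] := vertex_ltE.
have pab (S : {set _}) : S \subset J :|: top -> forall s, s \in S -> p < s < vb -> s = va.
  move=> SJ s sS /andP[ps sb]; have := subsetP SJ s sS.
  rewrite inE in_top => /orP[/p_max|/or3P[]/eqP sE //].
  - by rewrite leqNgt ps.
  - by rewrite sE ltnn in sb.
  by move: sb; rewrite sE ltnNge ltnW.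
have nJ t : t \in top -> t \in J = false by apply: notin_low.
have [at_ bt ct] := in_tops.
pose S1 := J :|: [set va; vb].
(* The composition of [J + va] with the edge [(va, vb)]. *)
have [||||||u1 [u1nat u1F u1thin]] := @inner_fill X _ F u S1 p va vb hX Fdc uF.
- by rewrite !inE pJ !eqxx !orbT.
- by rewrite pa ab.
- apply: pab; apply/subsetP=> s; rewrite !in_setU in_top !inE.
  by bool_cases.
- apply: contra nFJb; apply: Fdc; apply/subsetP=> s; rewrite !inE.
  case/orP=> [/eqP->|sJ]; first by rewrite vertex_eqE eqxx !orbT.
  by rewrite sJ andbT; apply: contraTneq sJ => ->; rewrite nJ.
- move=> j; rewrite !inE => /orP[jJ _|/orP[->//|/eqP-> _]].
    apply: Fdc (FJtop j jJ); apply/subsetP=> s.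
    by rewrite !in_setU in_top !inE; bool_cases.
  by apply: Fdc FJac; apply/subsetP=> s; rewrite !inE; bool_cases.
- move=> x /triE[x0 x1 x2]; apply: thin_u => //.
  by rewrite x0.
have F1dc := add_face_down (S := S1) Fdc.
(* The 2-cells from [J + vc] to that composition. *)
pose S2 := J :|: top.
have [||||||u2 [u2nat u2F u2thin]] := @inner_fill X _ _ u1 S2 p va vb hX F1dc u1nat.
- by rewrite !in_setU pJ at_ bt !orbT.
- by rewrite pa ab.
- exact: pab.
- rewrite /add_face negb_or; apply/andP; split.
    apply: contra nFJb; apply: Fdc; apply/subsetP=> s.
    rewrite in_setU1 in_setD1 in_setU => /orP[/eqP->|sJ].
      by rewrite vertex_eqE bt orbT.
    by rewrite sJ andbT; apply: contraTneq sJ => ->; rewrite nJ.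
  apply/subsetPn; exists vc; rewrite !inE ?vertex_eqE ?nJ //.
  by have := ct; rewrite inE.
- move=> j; rewrite in_setU in_top => /orP[jJ _|/or3P[/eqP->|/eqP-> _|/eqP-> _]].
  + apply/orP; left; apply: Fdc (FJtop j jJ); apply/subsetP=> s.
    by rewrite in_setD1 !in_setU in_top !inE; bool_cases.
  + by rewrite eqxx.
  + apply/orP; left; apply: Fdc FJac; apply/subsetP=> s.
    by rewrite in_setD1 !in_setU in_top !inE; bool_cases.
  + apply/orP; right; apply/subsetP=> s.
    by rewrite in_setD1 !in_setU in_top !inE; bool_cases.
- by move=> x xE _; apply: u1thin.
have FF1 S : F S -> add_face F S1 S by rewrite /add_face => ->.
exists u2; split.
- by apply: natural_sub u2nat => S /orP[/FF1 FS|SJ]; apply/orP; [left|right].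
- by move=> m x Fx; rewrite u2F ?u1F ?FF1.
move=> x x0 x1 x2; case: (altP (x ord0 =P p)) => [xp|xp].
  by apply: u2thin; apply/vertices2P; rewrite xp x1 x2.
have Fx : F (vimage x).
  apply: Fdc (FJtop p pJ); apply: subset_trans (triS x x0 x1 x2) _.
  rewrite !subUset !sub1set !in_setU in_setD1 x0 xp at_ bt.
  by rewrite !orbT.
by rewrite u2F ?u1F ?FF1 //; apply: thin_u.
Qed.

(** The faces of the original horn at [vc]: those of the face missing [vb] that
miss a further vertex other than [vc]. *)
Definition given_faces : pred {set 'I_l.+4} := fun S =>
  (vb \notin S) && [exists j : 'I_l.+4, (j < l.+2) && (j \notin S)].

(** The vertex sets reached once the members of [P] have been treated. For [P]
reduced to the empty set, these are the faces of the horn and those of the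
triangle [(va, vb, vc)]. *)
Definition stage (P : {set {set 'I_l.+4}}) : pred {set 'I_l.+4} := fun S =>
  given_faces S || [exists J in P, S \subset J :|: top].

Lemma given_faces_down : down_closed given_faces.
Proof.
move=> S T ST /andP[bT /existsP[j /andP[jl jT]]].
rewrite /given_faces (contra (subsetP ST _) bT); apply/existsP; exists j.
by rewrite jl (contra (subsetP ST _) jT).
Qed.

Lemma stage_down (P : {set {set 'I_l.+4}}) : down_closed (stage P).
Proof.
move=> S T ST /orP[/(given_faces_down ST)|/exists_inP[J JP TJ]].
  by rewrite /stage => ->.
by apply/orP; right; apply/exists_inP; exists J => //; apply: subset_trans TJ.
Qed.

Lemma stage_face (P : {set {set 'I_l.+4}}) (J S : {set 'I_l.+4}) :
  J \in P -> S \subset J :|: top -> stage P S.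
Proof. by move=> JP SJ; apply/orP; right; apply/exists_inP; exists J. Qed.

Lemma setU_top_low (J K : {set 'I_l.+4}) :
  J \subset low -> J \subset K :|: top -> J \subset K.
Proof.
move=> Jlow /subsetP JK; apply/subsetP=> x xJ; have := JK x xJ.
by rewrite in_setU low_notin_top ?orbF // (subsetP Jlow).
Qed.

Lemma given_faces_proper (J S : {set 'I_l.+4}) :
  J \proper low -> S \subset J :|: top -> vb \notin S -> given_faces S.
Proof.
case/properP=> Jlow [j jlow jJ] SJ bS; rewrite /given_faces bS /=.
apply/existsP; exists j; apply/andP; split; first by move: jlow; rewrite inE; lia.
apply: contra jJ => /(subsetP SJ); rewrite in_setU low_notin_top //.
by rewrite orbF.
Qed.

(** Induction on the number of members of [P]: a member [J] of maximal cardinality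
is treated last, so that its proper subsets have been treated before it. As [J] is
not all of [low], the face [J + (va, vc)] belongs to the horn. *)
Lemma extend_over_stage (X : scaled) (u0 : forall m, ordmap m l.+3 -> X m)
    (P : {set {set 'I_l.+4}}) :
  inner_extension X -> natural_on (stage [set set0]) u0 ->
  set0 \in P -> (forall J K : {set 'I_l.+4}, K \subset J -> J \in P -> K \in P) ->
  (forall J, J \in P -> J \proper low) ->
  exists u : forall m, ordmap m l.+3 -> X m,
    [/\ natural_on (stage P) u,
        forall m (x : ordmap m l.+3),
          stage [set set0] (vimage x) -> u m x = u0 m x
      & forall x : ordmap 2 l.+3, x ord0 \in low -> x (inord 1) = va ->
          x ord_max = vb -> stage P (vimage x) -> thin (u 2 x)].
Proof.
move=> hX u0nat; have [k] := ubnP #|P|; elim: k => // k IH in P *.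
rewrite ltnS => Pk P0 Pdc Plow.
have triJ (Q : {set {set 'I_l.+4}}) (x : ordmap 2 l.+3) : x ord0 \in low ->
    x (inord 1) = va -> x ord_max = vb -> stage Q (vimage x) ->
    exists J, [/\ J \in Q, x ord0 \in J & vimage x \subset J :|: top].
  move=> x0 _ x2 /orP[/andP[]|/exists_inP[J JQ xJ]].
    by rewrite -x2 mem_vimage.
  exists J; split=> //; have := subsetP xJ _ (mem_vimage x ord0).
  by rewrite in_setU (low_notin_top x0) orbF.
have [J JP Jmax] : exists2 J : {set 'I_l.+4}, J \in P & forall K, K \in P -> #|K| <= #|J|.
  case: (arg_maxnP (fun J : {set 'I_l.+4} => #|J|) P0) => J JP Jmax.
  by exists J.
have [J0|Jn0] := eqVneq J set0.
  have PE : P = [set set0].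
    apply/setP=> K; rewrite inE; apply/idP/eqP=> [/Jmax|-> //].
    by rewrite J0 cards0 leqn0 cards_eq0 => /eqP.
  rewrite PE; exists u0; split=> // x x0 x1 x2 Fx.
  have [K [/set1P -> ]] := triJ _ x x0 x1 x2 Fx.
  by rewrite inE.
have Jlow : J \subset low by rewrite proper_sub ?Plow.
pose Q := P :\ J.
have [||||u [unat uu0 uthin]] := IH Q.
- by rewrite (cardsD1 J) JP in Pk.
- by rewrite !inE eq_sym Jn0.
- move=> K L LK /setD1P[KJ KP]; rewrite !inE (Pdc _ _ LK KP) andbT.
  apply: contraNneq KJ => LJ; rewrite LJ in LK.
  by rewrite eq_sym eqEcard LK Jmax.
- by move=> K /setD1P[_ /Plow].
have [||||u' [u'nat u'u u'thin]] :=
  @extend_over_face X (stage Q) u J hX (@stage_down Q) unat Jn0 Jlow.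
- apply/orP; left; apply: (given_faces_proper (Plow _ JP)).
    by apply/subsetP=> s; rewrite !in_setU in_top !inE; bool_cases.
  have bJ : vb \in J = false by rewrite (notin_low Jlow) // in_top eqxx orbT.
  by rewrite !inE !vertex_eqE bJ.
- move=> j jJ; apply: (@stage_face _ (J :\ j)) => //.
  rewrite !inE (Pdc _ _ (subsetDl _ _) JP) andbT.
  by apply: contraTneq jJ => <-; rewrite !inE eqxx.
- rewrite /stage negb_or /given_faces !inE eqxx /=.
  apply/exists_inPn=> K /setD1P[KJ KP]; apply: contra KJ => bJK.
  rewrite eq_sym eqEcard Jmax // andbT; apply: setU_top_low => //.
  by apply: subset_trans bJK; apply: subsetU1.
- by move=> x x0 x1 x2; apply: uthin; rewrite ?(subsetP Jlow).
have stageE S : stage P S -> stage Q S || (S \subset J :|: top).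
  case/orP=> [FS|/exists_inP[K KP SK]]; first by rewrite /stage FS.
  have [<-|KJ] := eqVneq K J; first by rewrite SK orbT.
  by rewrite (@stage_face Q K) // !inE KJ.
exists u'; split.
- exact: natural_sub u'nat.
- move=> m x Fx; rewrite u'u ?uu0 //.
  case/orP: Fx => [Fx|/exists_inP[K /set1P-> xK]]; first by rewrite /stage Fx.
  by apply: stage_face xK; rewrite !inE P0 eq_sym Jn0.
move=> x x0 x1 x2 /stageE/orP[Fx|xJ]; first by rewrite u'u //; apply: uthin.
apply: u'thin => //; have := subsetP xJ _ (mem_vimage x ord0).
by rewrite in_setU (low_notin_top x0) orbF.
Qed.

Definition proper_stage : pred {set 'I_l.+4} :=
  stage [set J : {set 'I_l.+4} | J \proper low].

(** In the base the whole face missing [vb] is given. *)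
Definition target_faces : pred {set 'I_l.+4} := fun S =>
  (vb \notin S) || proper_stage S.

Lemma low_neq0 : low != set0.
Proof. by apply/set0Pn; exists ord0; rewrite inE. Qed.

Lemma lowU_top : low :|: top = setT.
Proof. by apply/setP=> x; rewrite !inE; lia. Qed.

Lemma proper_stage_down : down_closed proper_stage.
Proof. exact: stage_down. Qed.

Lemma given_proper_stage S : given_faces S -> proper_stage S.
Proof. by rewrite /proper_stage /stage => ->. Qed.

Lemma target_faces_down : down_closed target_faces.
Proof.
move=> S T ST /orP[bT|]; last first.
  by move/(stage_down ST) => FS; apply/orP; right.
by apply/orP; left; apply: contra bT; apply: (subsetP ST).
Qed.

Lemma proper_stage_low (j : 'I_l.+4) (S : {set 'I_l.+4}) :
  j \in low -> j \notin S -> proper_stage S.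
Proof.
move=> jl jS; apply: (@stage_face _ (low :\ j)); first by rewrite inE properD1.
apply/subsetP=> x xS; rewrite in_setU in_setD1 (contraTneq _ xS) //=; last first.
  by move=> ->.
by rewrite !inE; lia.
Qed.

Lemma proper_stage_given (j : 'I_l.+4) (S : {set 'I_l.+4}) :
  j < l.+2 -> j \notin S -> vb \notin S -> proper_stage S.
Proof.
move=> jl jS bS; apply: given_proper_stage; rewrite /given_faces bS /=.
by apply/existsP; exists j; rewrite jl.
Qed.

Lemma low_va (j : 'I_l.+4) : j < l.+2 -> (j \in low) || (j == va).
Proof. by rewrite inE -val_eqE /= vaE; lia. Qed.

Lemma proper_stageN (S : {set 'I_l.+4}) :
  low \subset S -> (va \in S) || (vb \in S) -> ~~ proper_stage S.
Proof.
move=> lowS abS; rewrite /proper_stage /stage negb_or; apply/andP; split.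
  apply/negP=> /andP[bS /existsP[j /andP[/low_va jl]]].
  rewrite (negbTE bS) orbF in abS.
  by case/orP: jl => [/(subsetP lowS)->|/eqP->] //; rewrite abS.
apply/exists_inPn=> J; rewrite inE => Jlow; apply/negP=> SJ.
have /setU_top_low lowJ := subset_trans lowS SJ.
by have := proper_sub_trans Jlow (lowJ (subxx _)); rewrite properxx.
Qed.

(** One more step, for [J = low], completes the simplex, because here
[low + (va, vc)] is among the faces given. *)
Lemma extend_over_low (X : scaled) (w : forall m, ordmap m l.+3 -> X m) :
  inner_extension X -> natural_on target_faces w ->
  (forall x : ordmap 2 l.+3, x ord0 \in low -> x (inord 1) = va ->
     x ord_max = vb -> target_faces (vimage x) -> thin (w 2 x)) ->
  exists2 V : smap (std l.+3) X,
    forall m (x : ordmap m l.+3), target_faces (vimage x) -> V m x = w m x &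
    forall x : ordmap 2 l.+3, x ord0 \in low -> x (inord 1) = va ->
      x ord_max = vb -> thin (V 2 x).
Proof.
move=> hX w_nat w_thin.
have bJ : vb \in low = false by rewrite (notin_low (subxx _)) // in_top eqxx orbT.
have [||||V [V_nat Vw V_thin]] :=
  extend_over_face hX target_faces_down w_nat low_neq0 (subxx _).
- by rewrite /target_faces !in_setU bJ !inE !vertex_eqE.
- move=> j jl; apply/orP; right; apply: (@proper_stage_low j) => //.
  by rewrite in_setU in_setD1 eqxx (low_notin_top jl).
- rewrite /target_faces negb_or negbK setU11 proper_stageN ?subsetU1 //=.
  by rewrite setU11 orbT.
- exact: w_thin.
have V_natT m p (g : ordmap m p) (x : std l.+3 p) : V m (act g x) = act g (V p x).
  by apply: V_nat; rewrite /add_face lowU_top subsetT orbT.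
by exists (@Smap (std l.+3) X V V_natT).
Qed.

(** The codegeneracy identifying [vb] with [vc]. It defines the partial map at the
start of the construction, and makes the edge [(vb, vc)] degenerate. *)
Fact merge_last_mono : monotone [ffun i : 'I_l.+4 => inord (minn i l.+2) : 'I_l.+3].
Proof.
apply/forallP=> i; apply/forallP=> j; apply/implyP=> ij.
by rewrite !ffunE !inordK; lia.
Qed.
Definition merge_last : ordmap l.+3 l.+2 := Ordmap merge_last_mono.

Lemma merge_lastE i : merge_last i = minn i l.+2 :> nat.
Proof. by rewrite ffunE inordK; lia. Qed.

Lemma merge_last_coface m (x : ordmap m l.+2) :
  ordcomp merge_last (ordcomp (coface vb) x) = x.
Proof.
apply: ordmap_eq => i; apply: ord_inj; rewrite !ordcompE merge_lastE cofaceE /=.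
by rewrite /bump vbE; have := ltn_ord (x i); lia.
Qed.

Lemma merge_last_horn m (x : ordmap m l.+3) : stage [set set0] (vimage x) ->
  horn_family ord_max (vimage (ordcomp merge_last x)).
Proof.
case/orP=> [/andP[_ /existsP[j /andP[jl jx]]]|/exists_inP[J /set1P-> xt]].
  apply/existsP; exists (inord j); apply/andP; split.
    by rewrite -val_eqE /= inordK; lia.
  apply: contra jx => /imsetP[k _ /(congr1 (@nat_of_ord _))].
  rewrite ordcompE merge_lastE inordK; last by lia.
  move=> jE; suff -> : j = x k by apply: mem_vimage.
  by apply/val_inj => /=; lia.
apply/existsP; exists ord0; apply/andP; split; first by rewrite -val_eqE.
apply/imsetP=> -[k _ /(congr1 (@nat_of_ord _))]; rewrite ordcompE merge_lastE.
by move/vimageP: xt => /(_ k); rewrite !inE /=; lia.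
Qed.

Lemma horn_given_faces m (x : ordmap m l.+2) :
  horn_family ord_max (vimage x) ->
  given_faces (vimage (ordcomp (coface vb) x)).
Proof.
case/existsP=> j /andP[jmax jx]; apply/andP; split.
  apply/imsetP=> -[k _]; rewrite ordcompE cofaceE => /eqP.
  by rewrite (negbTE (neq_lift _ _)).
have jl : j < l.+2.
  by move: jmax; rewrite -val_eqE /=; have := ltn_ord j; lia.
have bj : coface vb j = j :> nat by rewrite cofaceE /= /bump vbE; lia.
apply/existsP; exists (coface vb j); rewrite bj jl /=.
apply: contra jx => /imsetP[k _]; rewrite ordcompE => /coface_inj ->.
exact: mem_vimage.
Qed.

Lemma merge_last_coface_vc m (x : ordmap m l.+2) :
  ordcomp merge_last (ordcomp (coface vc) x) = x.
Proof.
apply: ordmap_eq => i; apply: ord_inj; rewrite !ordcompE merge_lastE cofaceE /=.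
by rewrite /bump vcE; have := ltn_ord (x i); lia.
Qed.

Lemma stage0_proper (S : {set 'I_l.+4}) : stage [set set0] S -> proper_stage S.
Proof.
case/orP=> [/given_proper_stage //|/exists_inP[J /set1P-> SJ]].
by apply: stage_face SJ; rewrite inE proper0 low_neq0.
Qed.

Lemma stage0_top (S : {set 'I_l.+4}) : S \subset top -> stage [set set0] S.
Proof. by move=> St; apply: (@stage_face _ set0); rewrite ?set0U ?inE. Qed.

Lemma low_subD1 (S : {set 'I_l.+4}) t :
  low \subset S -> t \in top -> low \subset S :\ t.
Proof.
move=> lowS tt; apply/subsetP=> j jl; rewrite in_setD1 (subsetP lowS) // andbT.
by apply: contraTneq jl => ->; rewrite (notin_low (subxx _)).
Qed.

Lemma low_subC1 t : t \in top -> low \subset [set~ t].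
Proof. by move=> tt; rewrite -setTD low_subD1 ?subsetT. Qed.

Lemma coface_vaE (i : 'I_l.+3) :
  coface va i = (if i < l.+1 then i : nat else i.+1) :> nat.
Proof. by rewrite cofaceE /= /bump vaE; case: (ltnP i l.+1); lia. Qed.

Lemma coface_vcE (i : 'I_l.+3) : coface vc i = i :> nat.
Proof. by rewrite cofaceE /= /bump vcE; have := ltn_ord i; lia. Qed.

Lemma coface_va_max : coface va ord_max = vc.
Proof. by apply: ord_inj; rewrite coface_vaE vcE /= ltnNge leqnSn. Qed.

Lemma coface_vc_max : coface vc ord_max = vb.
Proof. by apply: ord_inj; rewrite coface_vcE vbE. Qed.

(** The next three lemmas identify, in turn, the horns by which the construction is
completed: the missing faces are [low + vb], then [low + va], then
[low + (va, vc)]. *)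
Lemma collapsed_horn_shaped : horn_shaped proper_stage (coface va) ord_max.
Proof.
rewrite /horn_shaped vimage_coface coface_va_max; split.
  apply: proper_stageN; last by rewrite !inE !vertex_eqE orbT.
  by case: in_tops => *; rewrite low_subD1 ?low_subC1.
move=> j; rewrite -val_eqE /= => jmax; have := ltn_ord j.
case: (ltnP j l.+1) => [jl _|lj jl].
  by apply: (@proper_stage_low (coface va j)); rewrite !inE ?eqxx // coface_vaE jl.
have -> : coface va j = vb by apply: ord_inj; rewrite coface_vaE vbE; case: ltnP; lia.
by apply: (@proper_stage_given va); rewrite ?vaE // !inE eqxx // andbF.
Qed.

Definition collapsed_stage := add_face proper_stage (vimage (coface va)).

Lemma cartesian_horn_shaped : horn_shaped collapsed_stage (coface vc) ord_max.
Proof.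
rewrite /collapsed_stage /horn_shaped !vimage_coface coface_vc_max; split.
  rewrite /add_face negb_or; apply/andP; split.
    apply: proper_stageN; last by rewrite !inE !vertex_eqE.
    by case: in_tops => *; rewrite low_subD1 ?low_subC1.
  by apply/subsetPn; exists va; rewrite !inE ?vertex_eqE ?eqxx.
move=> j; rewrite -val_eqE /= => jmax; have := ltn_ord j.
case: (ltnP j l.+1) => [jl _|lj jl].
  apply/orP; left.
  by apply: (@proper_stage_low (coface vc j)); rewrite !inE ?eqxx // coface_vcE.
have -> : coface vc j = va by apply: ord_inj; rewrite coface_vcE vaE; lia.
by apply/orP; right; apply/subsetP=> i; rewrite !inE => /andP[].
Qed.

Definition cartesian_stage := add_face collapsed_stage (vimage (coface vc)).

Lemma inner_horn_shaped : horn_shaped cartesian_stage (ordid l.+3) vb.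
Proof.
rewrite /cartesian_stage /collapsed_stage /horn_shaped vimage_id !ffunE.
rewrite /add_face !vimage_coface; split.
  rewrite 2!negb_or -andbA; apply/and3P; split.
  - apply: proper_stageN; last by rewrite !inE !vertex_eqE.
    by case: in_tops => *; rewrite low_subD1 ?subsetT.
  - by apply/subsetPn; exists va; rewrite !inE ?vertex_eqE ?eqxx.
  by apply/subsetPn; exists vc; rewrite !inE ?vertex_eqE ?eqxx.
move=> j jb; rewrite ffunE setTD.
have [jt|] := boolP (j \in top); last first.
  move=> jt; rewrite (@proper_stage_low j) ?inE ?eqxx //.
  by move: jt; rewrite !inE; lia.
by move: jt; rewrite in_top (negbTE jb) => /orP[] /eqP->; rewrite subxx ?orbT.
Qed.

(** The state of the construction before those three lifts: a partial map [uE] into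
[E], which extends the horn [ut] and has its triangles [(i, va, vb)] thin, over a
full simplex [V] of [B] whose face missing [vb] is [v]. *)
Record is_doubling (E B : scaled) (f : scaled_map E B)
    (ut : forall m, ordmap m l.+2 -> E m) (v : smap (std l.+2) B)
    (uE : forall m, ordmap m l.+3 -> E m) (V : smap (std l.+3) B) : Prop :=
  IsDoubling {
    doubling_natural : natural_on proper_stage uE;
    doubling_base : forall m (x : ordmap m l.+3),
      stage [set set0] (vimage x) -> uE m x = ut m (ordcomp merge_last x);
    doubling_thin : forall x : ordmap 2 l.+3, x ord0 \in low ->
      x (inord 1) = va -> x ord_max = vb -> proper_stage (vimage x) ->
      thin (uE 2 x);
    doubling_map : forall m (x : ordmap m l.+3),
      proper_stage (vimage x) -> f m (uE m x) = V m x;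
    doubling_coface : forall m (x : ordmap m l.+2),
      V m (ordcomp (coface vb) x) = v m x;
    doubling_thin_base : forall x : ordmap 2 l.+3, x ord0 \in low ->
      x (inord 1) = va -> x ord_max = vb -> thin (V 2 x) }.

Lemma exists_doubling (E B : scaled) (f : scaled_map E B)
    (ut : forall m, ordmap m l.+2 -> E m) (v : smap (std l.+2) B) :
  inner_extension E -> inner_extension B ->
  natural_on (horn_family ord_max) ut ->
  (forall m (x : ordmap m l.+2),
     horn_family ord_max (vimage x) -> f m (ut m x) = v m x) ->
  exists uE V, is_doubling f ut v uE V.
Proof.
move=> hE hB ut_nat fut.
pose u0 m (x : ordmap m l.+3) : E m := ut m (ordcomp merge_last x).
have u0_nat : natural_on (stage [set set0]) u0.
  by move=> m p g x xs; rewrite /u0 ordcompA ut_nat // merge_last_horn.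
have [|||uE [uE_nat uEu0 uE_thin]] :=
  @extend_over_stage E u0 [set J : {set 'I_l.+4} | J \proper low] hE u0_nat.
- by rewrite inE proper0 low_neq0.
- by move=> J K KJ; rewrite !inE; apply: sub_proper_trans.
- by move=> J; rewrite inE.
have given_stage (S : {set 'I_l.+4}) : proper_stage S -> vb \notin S -> given_faces S.
  case/orP=> [//|/exists_inP[J]]; rewrite inE => Jlow SJ bS.
  exact: given_faces_proper Jlow SJ bS.
have uEu0' m (x : ordmap m l.+3) : given_faces (vimage x) -> uE m x = u0 m x.
  by move=> xo; apply: uEu0; rewrite /stage xo.
pose w m (x : ordmap m l.+3) : B m :=
  if vb \notin vimage x then v m (ordcomp merge_last x) else f m (uE m x).
have wE m (x : ordmap m l.+3) : proper_stage (vimage x) -> w m x = f m (uE m x).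
  rewrite /w; case: ifP => // bx xs; have xo := given_stage _ xs bx.
  by rewrite uEu0' // fut // merge_last_horn // /stage xo.
have w_nat : natural_on target_faces w.
  move=> m p g x /orP[bx|xs].
    rewrite /w bx (contra (subsetP (vimage_comp x g) _)) //.
    by rewrite ordcompA -smap_nat.
  by rewrite !wE ?uE_nat ?smap_nat // (proper_stage_down (vimage_comp x g)).
have [|V Vw V_thin] := extend_over_low hB w_nat.
  move=> x x0 x1 x2 /orP[|xs]; first by rewrite -x2 mem_vimage.
  by rewrite wE //; apply: (@scaled_thin _ _ f); apply: uE_thin.
exists uE, V; split=> //.
  by move=> m x xs; rewrite Vw ?wE //; apply/orP; right.
move=> m x; have bx : vb \notin vimage (ordcomp (coface vb) x).
  apply/imsetP=> -[k _]; rewrite ordcompE cofaceE => /eqP.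
  by rewrite (negbTE (neq_lift _ _)).
by rewrite Vw /target_faces ?bx // /w bx merge_last_coface.
Qed.

Lemma doubling_given (E B : scaled) (f : scaled_map E B) ut v uE V
    (dbl : @is_doubling E B f ut v uE V) m (x : ordmap m l.+3) :
  given_faces (vimage x) -> uE m x = ut m (ordcomp merge_last x).
Proof. by move=> xo; apply: (doubling_base dbl); rewrite /stage xo. Qed.

(** In the 3-simplex [(0, va, vb, vc)], available because [0] is not the whole of
[low] when [(0, va, vc)] lies in the horn, the triangles [(0, va, vb)],
[(0, va, vc)] and [(va, vb, vc)] are thin; so is the fourth, by saturation. *)
Lemma doubling_thin_vbc (E B : scaled) (f : scaled_map E B) ut v uE V
    (dbl : @is_doubling E B f ut v uE V) (x : ordmap 2 l.+2) (y : ordmap 2 l.+3) :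
  extension saturation_incl E -> natural_on (horn_family ord_max) ut ->
  horn_family ord_max (vimage x) ->
  vertices (x : std _ 2) = [:: 0; l.+1; l.+2] ->
  vertices (y : std _ 2) = [:: 0; l.+2; l.+3] ->
  thin (ut 2 x) -> thin (uE 2 y).
Proof.
move=> hE ut_nat xh /vertices2P[x0 x1 x2] /vertices2P[y0 y1 y2] ut_thin.
have l_gt0 : 0 < l.
  case/existsP: xh => j /andP[jmax /imsetP jx]; rewrite lt0n; apply/eqP=> l0.
  have [j0|j1] : j = 0 :> nat \/ j = l.+1 :> nat.
    by move: jmax; rewrite -val_eqE /=; have := ltn_ord j; lia.
    by apply: jx; exists ord0 => //; apply: ord_inj; rewrite x0.
  by apply: jx; exists (inord 1) => //; apply: ord_inj; rewrite x1.
have [i j ij|z zE] :=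
  @exists_ordmap 3 l.+3 (fun i => inord (if i == 0 :> nat then 0 else l + i)).
  have i4 := ltn_ord i; have j4 := ltn_ord j.
  by case: eqP => i0; case: eqP => j0; rewrite ?inordK; lia.
have zN i : z i = (if i == 0 :> nat then 0 else l + i) :> nat.
  by rewrite zE inordK //; by have := ltn_ord i; case: eqP; lia.
have z_stage : proper_stage (vimage z).
  apply: (@proper_stage_low (inord 1)).
    by rewrite inE inordK; lia.
  apply/imsetP=> -[k _ /(congr1 (@nat_of_ord _))].
  by rewrite zN inordK; [case: eqP; lia|lia].
have zg (g : ordmap 2 3) : act g (uE 3 z) = uE 2 (ordcomp z g).
  by rewrite (doubling_natural dbl).
have zg_stage (g : ordmap 2 3) : proper_stage (vimage (ordcomp z g)).
  exact: proper_stage_down (vimage_comp _ _) z_stage.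
have [i j|g gE] :=
  @exists_ordmap 2 3 (fun i => inord (if i == 0 :> nat then 0 else i.+1)).
  by case: i => [[|[|[|//]]] ?]; case: j => [[|[|[|//]]] ?]; rewrite /= ?inordK.
have gN i : g i = (if i == 0 :> nat then 0 else i.+1) :> nat.
  by rewrite gE inordK //; case: i => [[|[|[|//]]] ?].
have -> : y = ordcomp z g.
  apply: ordmap_eq => i; apply: ord_inj; rewrite ordcompE zN gN.
  by case: (ord3P i) => ->; rewrite ?y0 ?y1 ?y2 /= ?inordK //=; lia.
rewrite -zg; apply: thin_of_saturation => //; last first.
  by apply/vertices2P; rewrite !gN /= ?inordK.
move=> {gE gN} {}g; rewrite !inE => /or3P[] /eqP/vertices2P[g0 g1 g2]; rewrite zg.
- apply: (doubling_thin dbl) => //; rewrite ?inE ordcompE.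
  + by rewrite zN g0.
  + by apply: ord_inj; rewrite zN g1 vaE /= addn1.
  + by apply: ord_inj; rewrite zN g2 vbE /= addn2.
- rewrite (doubling_given dbl); last first.
    apply/andP; split.
      apply/imsetP=> -[k _ /(congr1 (@nat_of_ord _))]; rewrite ordcompE zN vbE.
      by case: (ord3P k) => ->; rewrite ?g0 ?g1 ?g2 /=; lia.
    apply/existsP; exists (inord 1); rewrite inordK ?l_gt0; last by lia.
    apply/imsetP=> -[k _ /(congr1 (@nat_of_ord _))].
    rewrite ordcompE zN inordK; last by lia.
    by case: (ord3P k) => ->; rewrite ?g0 ?g1 ?g2 /=; lia.
  suff -> : ordcomp merge_last (ordcomp z g) = x by [].
  apply: ordmap_eq => i; apply: ord_inj; rewrite !ordcompE merge_lastE zN.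
  by case: (ord3P i) => ->; rewrite ?g0 ?g1 ?g2 ?x0 ?x1 ?x2 /=; lia.
have zt : stage [set set0] (vimage (ordcomp z g)).
  apply: stage0_top; apply/vimageP=> i; rewrite inE ordcompE zN.
  by case: (ord3P i) => ->; rewrite ?g0 ?g1 ?g2 /=; lia.
rewrite (doubling_base dbl) //; apply: thin_degenerate.
apply: natural_degenerate ut_nat (merge_last_horn zt) _ => zI.
suff /zI/(congr1 (@nat_of_ord _)) : ordcomp merge_last (ordcomp z g) (inord 1) =
  ordcomp merge_last (ordcomp z g) ord_max by rewrite /= inordK.
by apply: ord_inj; rewrite !ordcompE !merge_lastE !zN g1 g2 /=; lia.
Qed.

(** The last hypothesis provides lifts of last horns whose last edge is constant,
and thereby covers weak and outer fibrations: a weak fibration needs the triangle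
[(0, n - 1, n)] of such a horn to be thin, which here may be deduced from its being
thin in [u]. *)
Lemma lift_last_horn (E B : scaled) (f : scaled_map E B) (e : E 1)
    (u : smap (sub_sset (horn (@ord_max l.+2))) E) (v : smap (std l.+2) B) :
  inner_extension E -> extension saturation_incl E -> inner_extension B ->
  (forall n (i : 'I_n.+1), 0 < i < n -> rlp (inner_incl i) f) ->
  weakly_cartesian f e ->
  commutes (horn_incl ord_max) f u v ->
  (forall d : sub_sset (horn (@ord_max l.+2)) 1,
     vertices (horn_incl ord_max 1 d) = [:: l.+1; l.+2] -> u 1 d = e) ->
  (forall (u1 : smap (sub_sset (horn (@ord_max l.+2))) E)
      (v1 : smap (std l.+2) B) (p : smap (std 0) E),
     commutes (horn_incl ord_max) f u1 v1 ->
     (forall m (x : sub_sset (horn (@ord_max l.+2)) m) t,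
        smem (face l.+2 [:: l.+1; l.+2]) (val x) -> u1 m x = p m t) ->
     (forall x : sub_sset (horn (@ord_max l.+2)) 2,
        vertices (val x) = [:: 0; l.+1; l.+2] -> thin (u 2 x) -> thin (u1 2 x)) ->
     exists w, is_lift (horn_incl ord_max) f u1 v1 w) ->
  exists w, is_lift (horn_incl ord_max) f u v w.
Proof.
move=> hE hEs hB hf we fu ue hcol.
have [ut ut_nat utE] := horn_extend e u.
have fut m (x : ordmap m l.+2) : horn_family ord_max (vimage x) -> f m (ut m x) = v m x.
  rewrite -horn_familyE => xh; have := fu m (exist _ (x : std l.+2 m) xh).
  by rewrite -utE.
have [uE [V dbl]] := exists_doubling hE hB ut_nat fut.
have Fdc := proper_stage_down.
have uE_nat := doubling_natural dbl; have fuE := doubling_map dbl.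
have uE_given := doubling_given dbl.
(* First lift: the face missing [va], whose last edge [(vb, vc)] is constant. *)
have [ud3 [ud3E fud3 glue3]] :=
  lift_face Fdc uE_nat fuE (@coface_inj _ va) collapsed_horn_shaped.
have [//|vtx vtxE] := @exists_ordmap 0 l.+2 (fun=> ord_max).
have maxh m (t : ordmap m 0) : horn_family ord_max (vimage (ordcomp vtx t)).
  apply/existsP; exists ord0; rewrite -val_eqE /=.
  by apply/imsetP=> -[k _]; rewrite ordcompE vtxE => /(congr1 (@nat_of_ord _)).
have p_nat m q (g : ordmap m q) (t : std 0 q) :
    ut m (ordcomp vtx (act g t)) = act g (ut q (ordcomp vtx t)).
  by rewrite /= ordcompA ut_nat.
pose p := @Smap (std 0) E (fun m t => ut m (ordcomp vtx t)) p_nat.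
have [||w3 lift3] := hcol ud3 _ p fud3.
- move=> m [x xh] t /forallP/= xL; rewrite ud3E /=.
  have xv i : x i = l.+1 :> nat \/ x i = l.+2 :> nat.
    by move: (xL i); rewrite !inE => /orP[] /eqP; [left|right].
  rewrite (doubling_base dbl); last first.
    apply: stage0_top; apply/vimageP=> i; rewrite inE ordcompE coface_vaE.
    by case: (xv i) => ->; case: ifP; lia.
  congr (ut _ _); apply: ordmap_eq => i; apply: ord_inj.
  rewrite !ordcompE vtxE merge_lastE coface_vaE /=.
  by case: (xv i) => ->; case: ifP; lia.
- move=> x xE; rewrite -utE ud3E; apply: (doubling_thin_vbc dbl) => //.
    by rewrite -horn_familyE (valP x).
  case/vertices2P: xE => x0 x1 x2.
  by apply/vertices2P; rewrite !ordcompE !coface_vaE x0 x1 x2 /= !ltnn ltnNge leqnSn.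
have [u3 [u3_nat u3E fu3]] := glue3 w3 lift3.
have F3dc : down_closed collapsed_stage by apply: add_face_down.
have PF3 S : proper_stage S -> collapsed_stage S.
  by rewrite /collapsed_stage /add_face => ->.
(* Second lift: the face missing [vc], whose last edge is [e]. *)
have [ud4 [ud4E fud4 glue4]] :=
  lift_face F3dc u3_nat fu3 (@coface_inj _ vc) cartesian_horn_shaped.
have tri4 (y : ordmap 2 l.+2) :
    [/\ y ord0 < l.+1, y (inord 1) = l.+1 :> nat & y ord_max = l.+2 :> nat] ->
    let x := ordcomp (coface vc) y in
    [/\ x ord0 \in low, x (inord 1) = va & x ord_max = vb].
  case=> y0 y1 y2 x; rewrite /x !ordcompE inE coface_vcE; split=> //; apply: ord_inj.
    by rewrite coface_vcE y1 vaE.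
  by rewrite coface_vcE y2 vbE.
have ud4T (y : sub_sset (horn (@ord_max l.+2)) 2) :
    contains_edge l.+1 l.+2 (horn_incl ord_max 2 y) -> thin (ud4 2 y).
  move/contains_last_edge=> yE.
  have yF : collapsed_stage (vimage (ordcomp (coface vc) (val y))).
    by rewrite -(horn_shapedP F3dc (@coface_inj _ vc) cartesian_horn_shaped) (valP y).
  rewrite ud4E; case: yE => [/tri4[x0 x1 x2]|yI].
    have xP : proper_stage (vimage (ordcomp (coface vc) (val y))).
      case/orP: yF => //; rewrite vimage_coface => /subsetP/(_ va).
      by rewrite !inE eqxx -x1 mem_vimage => /(_ isT).
    by rewrite u3E //; apply: (doubling_thin dbl).
  apply: thin_degenerate; apply: natural_degenerate u3_nat yF _.
  by move/ordcomp_inj.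
have V4T (y : std l.+2 2) : contains_edge l.+1 l.+2 y ->
    thin (smap_comp V (std_map (coface vc)) 2 y).
  case/contains_last_edge=> [/tri4[x0 x1 x2]|yI].
    exact: (doubling_thin_base dbl).
  exact/thin_degenerate/smap_degenerate.
have [||w4 lift4] := we l.+2 isT (scaled_map_of ud4T) (scaled_map_of V4T).
- exact: fud4.
- move=> d dE; rewrite /= ud4E -(ue d dE) -utE.
  have xt : stage [set set0] (vimage (ordcomp (coface vc) (val d))).
    apply: stage0_top; apply/vimageP=> i; rewrite inE ordcompE coface_vcE.
    have : nat_of_ord (val d i) \in vertices (horn_incl ord_max 1 d).
      by apply: map_f; rewrite mem_enum.
    by rewrite dE !inE; lia.
  rewrite u3E ?PF3 //; last exact: stage0_proper.
  by rewrite (doubling_base dbl) // merge_last_coface_vc.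
have [u4 [u4_nat u4E fu4]] := glue4 w4 lift4.
have F4dc : down_closed cartesian_stage by apply: add_face_down.
have PF4 S : proper_stage S -> cartesian_stage S.
  by move=> /PF3 FS; rewrite /cartesian_stage /add_face FS.
have u4_stage m (x : ordmap m l.+3) : proper_stage (vimage x) -> u4 m x = uE m x.
  by move=> xP; rewrite u4E ?u3E ?PF3.
(* Third lift: the whole simplex, from its inner horn at [vb]. *)
have [ud5 [ud5E fud5 _]] := lift_face F4dc u4_nat fu4 (@ordid_inj _) inner_horn_shaped.
have tri5 (y : ordmap 2 l.+3) :
    vertices (y : std _ 2) = [:: vb.-1; nat_of_ord vb; vb.+1] ->
    thin (u4 2 y) /\ thin (V 2 y).
  rewrite vbE => /vertices2P[y0 y1 y2].
  have yt : stage [set set0] (vimage y).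
    apply: stage0_top; apply/vimageP=> i; rewrite inE.
    by case: (ord3P i) => ->; rewrite ?y0 ?y1 ?y2 /=; lia.
  suff yT : thin (uE 2 y).
    rewrite u4_stage ?stage0_proper // -fuE ?stage0_proper //; split=> //.
    exact: (@scaled_thin _ _ f).
  rewrite (doubling_base dbl) //; apply: thin_degenerate.
  apply: natural_degenerate ut_nat (merge_last_horn yt) _ => yI.
  suff /yI/(congr1 (@nat_of_ord _)) : ordcomp merge_last y (inord 1) =
    ordcomp merge_last y ord_max by rewrite /= inordK.
  by apply: ord_inj; rewrite !ordcompE !merge_lastE y1 y2; lia.
have ud5T (y : sub_sset (horn vb) 2) :
    triangles [:: [:: vb.-1; nat_of_ord vb; vb.+1]] (horn_incl vb 2 y) ->
    thin (ud5 2 y).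
  by rewrite /triangles inE ud5E ordcomp_id => /eqP/tri5[].
have V5T (y : std l.+3 2) :
    triangles [:: [:: vb.-1; nat_of_ord vb; vb.+1]] y ->
    thin (smap_comp V (std_map (ordid l.+3)) 2 y).
  by rewrite /triangles inE /= ordcomp_id => /eqP/tri5[].
have b_inner : 0 < vb < l.+3 by rewrite vbE; lia.
have [w5 [w5u fw5]] := hf l.+3 vb b_inner (scaled_map_of ud5T) (scaled_map_of V5T) fud5.
exists (smap_comp w5 (std_map (coface vb))); split=> m x; last first.
  by rewrite /= fw5 /= ordcomp_id (doubling_coface dbl).
have xh : horn_family ord_max (vimage (val x)) by rewrite -horn_familyE (valP x).
have xo := horn_given_faces xh.
have xP := given_proper_stage xo.
have yh : smem (horn vb) (ordcomp (coface vb) (val x) : std l.+3 m).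
  by rewrite (horn_shapedP F4dc (@ordid_inj _) inner_horn_shaped) ordcomp_id PF4.
have := w5u m (exist _ (ordcomp (coface vb) (val x) : std l.+3 m) yh).
rewrite /= ud5E /= ordcomp_id u4_stage // uE_given // merge_last_coface utE => <-.
by [].
Qed.

End DoubledVertex.

(** * Comparison of the three classes of edges *)

Section Comparison.
Variables (E B : scaled) (f : scaled_map E B).

(** The larger scaling of the weak condition matters only for triangles
[(i, n-1, n)] with [i] positive, and these lie in the horn because they miss the
vertex 0. *)
Lemma cartesian_weakly_cartesian (e : E 1) :
  cartesian f e -> weakly_cartesian f e.
Proof.
move=> ce [|[|l]] // l2 i u v fu ue.
have sub := @triangle_contains_edge l.
have uT (x : sub_sset (horn (@ord_max l.+2)) 2) :
    triangles [:: [:: 0; l.+1; l.+2]] (horn_incl ord_max 2 x) -> thin (u 2 x).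
  by move/sub => xT; apply: (@scaled_thin _ _ u); left.
have vT (x : std l.+2 2) : triangles [:: [:: 0; l.+1; l.+2]] x -> thin (v 2 x).
  by move/sub => xT; apply: (@scaled_thin _ _ v); left.
have [w [wu fw]] := ce l.+2 l2 (scaled_map_of uT) (scaled_map_of vT) fu ue.
have wT (y : std l.+2 2) : contains_edge l.+1 l.+2 y -> thin (w 2 y).
  move=> yT; case: (contains_last_edge yT) => [[y0 y1 y2]|yI]; last first.
    exact/thin_degenerate/(degenerate_map w)/std_degenerate.
  have [y00|y0n] := eqVneq (nat_of_ord ((y : ordmap 2 l.+2) ord0)) 0.
    apply: (@scaled_thin _ _ w); left; rewrite /triangles inE; apply/eqP.
    exact/vertices2P.
  have yh : smem (horn ord_max) y.
    rewrite horn_familyE; apply/existsP; exists ord0; rewrite -val_eqE /=.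
    apply/imsetP=> -[k _ /(congr1 (@nat_of_ord _))] /=.
    by case: (ord3P k) => ->; rewrite ?y1 ?y2 //; move/esym/eqP; apply/negP.
  have -> : w 2 y = u 2 (exist _ y yh) by rewrite -[RHS]/(u 2 _) -wu.
  by apply: (@scaled_thin _ _ u); left.
by exists (scaled_map_of wT).
Qed.

Lemma face_last_edge_horn l m (x : std l.+2 m) :
  smem (face l.+2 [:: l.+1; l.+2]) x -> smem (horn ord_max) x.
Proof.
move=> /forallP xL; rewrite horn_familyE; apply/existsP; exists ord0.
rewrite -val_eqE /=; apply/imsetP=> -[k _ x0].
by have := xL k; rewrite -x0 !inE.
Qed.

Lemma weakly_cartesian_cartesian (e : E 1) :
  infty_bicategory E -> infty_bicategory B -> weak_fibration f ->
  weakly_cartesian f e -> cartesian f e.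
Proof.
move=> hE hB hf we [|[|l]] // l2 i u v fu ue.
case: l => [|l] in l2 i u v fu ue *.
  (* In dimension 2 both scalings consist of the same nondegenerate triangle. *)
  have T2 (y : std 2 2) : contains_edge 1 2 y ->
      triangles [:: [:: 0; 1; 2]] y \/ degenerate y.
    case/contains_last_edge=> [[y0 y1 y2]|/std_degenerate]; [left|by right].
    rewrite /triangles inE; apply/eqP/vertices2P; split=> //.
    by apply/eqP; rewrite -leqn0.
  have uT (x : sub_sset (horn (@ord_max 2)) 2) :
      contains_edge 1 2 (horn_incl ord_max 2 x) -> thin (u 2 x).
    move=> xT; case: (contains_last_edge xT) => [[x0 x1 x2]|xI].
      apply: (@scaled_thin _ _ u); left; rewrite /triangles inE.
      by apply/eqP/vertices2P; split=> //; apply/eqP; rewrite -leqn0.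
    have [ut ut_nat utE] := horn_extend e u.
    rewrite -[u 2 x]/(smap_fun u 2 x) -utE; apply: thin_degenerate.
    by apply: natural_degenerate ut_nat _ xI; rewrite -horn_familyE (valP x).
  have vT (x : std 2 2) : contains_edge 1 2 x -> thin (v 2 x).
    by move/T2=> xT; apply: (@scaled_thin _ _ v).
  have [w [wu fw]] := we 2 l2 (scaled_map_of uT) (scaled_map_of vT) fu ue.
  have wT (y : std 2 2) : triangles [:: [:: 0; 1; 2]] y -> thin (w 2 y).
    by move/triangle_contains_edge=> yT; apply: (@scaled_thin _ _ w); left.
  by exists (scaled_map_of wT).
(* The vertex 1 lies strictly between 0 and [n - 1]. *)
have triH (y : std l.+3 2) : triangles [:: [:: 0; l.+2; l.+3]] y -> smem (horn ord_max) y.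
  rewrite /triangles inE => /eqP/vertices2P[y0 y1 y2].
  rewrite horn_familyE; apply/existsP; exists (inord 1).
  rewrite -val_eqE /= inordK //=; apply/imsetP=> -[k _ /(congr1 (@nat_of_ord _))].
  by rewrite inordK //; case: (ord3P k) => ->; rewrite ?y0 ?y1 ?y2.
have [] := lift_last_horn (bicat_inner hE) (bicat_saturation hE) (bicat_inner hB)
  (weak_inner hf) we fu ue.
  move=> u1 v1 p fu1 u1p u1T.
  have u1T' (x : sub_sset (horn (@ord_max l.+3)) 2) :
      triangles [:: [:: 0; l.+2; l.+3]] (val x) -> thin (u1 2 x).
    move=> xT; apply: u1T; first by move: xT; rewrite /triangles inE => /eqP.
    by apply: (@scaled_thin _ _ u); left.
  apply: (weak_lift (@face_last_edge_horn l.+1) (weak_right hf l2) fu1 u1p u1T').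
  move=> x xT; have := fu1 2 (exist _ x (triH x xT)); rewrite /= => <-.
  by apply: (@scaled_thin _ _ f); apply: u1T'.
move=> w [wu fw].
have wT (y : std l.+3 2) : triangles [:: [:: 0; l.+2; l.+3]] y -> thin (w 2 y).
  move=> yT; have := wu 2 (exist _ y (triH y yT)); rewrite /= => ->.
  by apply: (@scaled_thin _ _ u); left.
by exists (scaled_map_of wT).
Qed.

Lemma weakly_cartesian_strongly_cartesian (e : E 1) :
  infty_bicategory E -> infty_bicategory B -> outer_fibration f ->
  weakly_cartesian f e -> strongly_cartesian f e.
Proof.
move=> hE hB hf we [|[|l]] // l2 i u v fu ue.
have [] := lift_last_horn (bicat_inner hE) (bicat_saturation hE) (bicat_inner hB)
  (weak_inner (outer_weak hf)) we fu ue.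
  move=> u1 v1 p fu1 u1p _.
  exact: (outer_lift (@face_last_edge_horn l) (outer_right hf l2) fu1 u1p).
move=> w wl; have wT (y : std l.+2 2) : False -> thin (w 2 y) by [].
by exists (scaled_map_of wT).
Qed.

(** The triangle [(0, n-1, n)] of the lift is thin because its image is. *)
Lemma strongly_cartesian_cartesian (e : E 1) :
  outer_fibration f -> strongly_cartesian f e -> cartesian f e.
Proof.
move=> hf se n n2 i u v fu ue.
have uT (x : sub_sset (horn (@ord_max n)) 2) : False -> thin (u 2 x) by [].
have vT (x : std n 2) : False -> thin (v 2 x) by [].
have [w [wu fw]] := se n n2 (scaled_map_of uT) (scaled_map_of vT) fu ue.
have wT (y : std n 2) : triangles [:: [:: 0; n.-1; n]] y -> thin (w 2 y).
  by move=> yT; apply/(outer_thin hf); rewrite fw; apply: (@scaled_thin _ _ v); left.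
by exists (scaled_map_of wT).
Qed.
End Comparison.

Theorem proposition2p3p7 (E B : scaled)
    (hE : infty_bicategory E) (hB : infty_bicategory B)
    (f : scaled_map E B) (hf : weak_fibration f) :
  (forall e : E 1, cartesian f e <-> weakly_cartesian f e) /\
  (outer_fibration f ->
     (forall e : E 1, cartesian f e <-> strongly_cartesian f e) /\
     (forall e : E 1,
        [/\ cartesian f e <-> weakly_cartesian f e,
            cartesian f e <-> strongly_cartesian f e
          & weakly_cartesian f e <-> strongly_cartesian f e])).
Proof.
have cw e : cartesian f e <-> weakly_cartesian f e.
  split; first exact: cartesian_weakly_cartesian.
  exact: weakly_cartesian_cartesian.
split=> // hfo.
have ws e : weakly_cartesian f e <-> strongly_cartesian f e.
  split; first exact: weakly_cartesian_strongly_cartesian.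
  by move/(strongly_cartesian_cartesian hfo)/cw.
have cs e : cartesian f e <-> strongly_cartesian f e by rewrite cw.
by split=> // e; split.
Qed.
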